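(* Let $f_i:M_i^{k_i}\to\mathbb S^{2n_i+1}\subset\mathbb C^{n_i+1}$, $i=1,2$, be $\mathscr C$-totally real immersions, let $\gamma=(z_1,z_2):I\to\mathbb S^3\subset\mathbb C^2$ be an immersed smooth curve on a connected interval $I$, and suppose that the spiral product $$G_\gamma(t,x,y)=\bigl(z_1(t)f_1(x),z_2(t)f_2(y)\bigr),\qquad G_\gamma:I\times M_1\times M_2\to\mathbb S^{2n_1+2n_2+3},$$ is an immersion. Then $G_\gamma$ is minimal if and only if both $f_1$ and $f_2$ are minimal (in their respective spheres) and $\gamma$ is an unparametrized geodesic of the weighted metric $\bar g=|z_1|^{2k_1}|z_2|^{2k_2}\,g_{\mathbb S^3}$ on $\mathbb S^3$.
   Context: All manifolds are smooth and without boundary. On complex Euclidean space $Jz=iz$, $\langle\cdot,\cdot\rangle$ is the real Euclidean inner product, and on the unit sphere $\alpha_z(v)=\langle Jz,v\rangle$. A smooth immersion $f:M^k\to\mathbb S^{2n+1}\subset\mathbb C^{n+1}$ is $\mathscr C$-totally real if $f^*\alpha=0$, i.e. $\langle Jf,df(X)\rangle=0$ for all $X\in TM$. The dimensions $k_i\ge 0$; a connected zero-dimensional factor is a point (and is trivially minimal). $g_{\mathbb S^3}$ is the standard round metric; powers with exponent $0$ are $1$. If $G_\gamma$ is an immersion and $\gamma$ meets $\{z_i=0\}$, then necessarily $k_i=0$, so $\bar g$ is smooth and nondegenerate near every point of $\gamma$. ''Minimal'' means vanishing mean curvature vector in the unit sphere. *)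

(* Defs.v *)
From HB Require Import structures.
From mathcomp Require Import all_boot all_order all_algebra.
From mathcomp Require Import all_classical all_reals all_analysis.
Set Implicit Arguments.
Unset Strict Implicit.
Unset Printing Implicit Defensive.
Import Order.TTheory GRing.Theory Num.Theory.
Import numFieldNormedType.Exports.
Local Open Scope ring_scope.
Local Open Scope classical_set_scope.

(* C^m is stored as the real matrices 'M[R]_(2, m): row 0 holds the real parts
   and row 1 the imaginary parts.  (Matrices over R[i] carry no normed
   R-module structure, so they cannot be differentiated along real
   parameters.)  In particular a complex number is a 'cV[R]_2 and the j-th
   complex coordinate of w is col j w. *)
Section ComplexSpace.
Variables (R : realType) (m : nat).
Implicit Types v w : 'M[R]_(2, m).

Definition inner v w : R := \sum_(i < 2) \sum_(j < m) v i j * w i j.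

(* i (x + i y) = - y + i x *)
Definition mulJ w : 'M[R]_(2, m) :=
  \matrix_(i, j) (if i == 0 then - w 1 j else w 0 j).

Definition cscale (z : 'cV[R]_2) w : 'M[R]_(2, m) :=
  z 0 0 *: w + z 1 0 *: mulJ w.

(* The unit sphere S^(2m-1) of C^m. *)
Definition usphere : set 'M[R]_(2, m) := [set w | inner w w = 1].

End ComplexSpace.

Section Smooth.
Variables (R : realType) (V W : normedModType R).

(* For V finite-dimensional and U open, [Cn_on n U f] is the class C^n. *)
Fixpoint Cn_on (n : nat) (U : set V) (f : V -> W) : Prop :=
  match n with
  | 0 => forall x, U x -> {for x, continuous f}
  | p.+1 => (forall x, U x -> differentiable f x) /\
            (forall v : V, Cn_on p U ('D_v f))
  end.

Definition smooth_on (U : set V) (f : V -> W) : Prop := forall n, Cn_on n U f.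

End Smooth.

(* A chart identifies [chart_dom c] with [chart_cod c] through the mutually
   inverse maps [coords c] and [param c], whose values elsewhere are
   irrelevant. *)
Record chart (R : realType) (T : Type) (k : nat) := Chart {
  chart_dom : set T;
  chart_cod : set 'rV[R]_k;
  coords : T -> 'rV[R]_k;
  param : 'rV[R]_k -> T }.

Definition is_chart (R : realType) (T : topologicalType) k
    (c : chart R T k) : Prop :=
  [/\ open (chart_dom c) /\ open (chart_cod c),
      forall x, chart_dom c x ->
        chart_cod c (coords c x) /\ param c (coords c x) = x,
      forall u, chart_cod c u ->
        chart_dom c (param c u) /\ coords c (param c u) = u,
      forall x, chart_dom c x -> {for x, continuous (coords c)} &
      forall u, chart_cod c u -> {for u, continuous (param c)}].

Definition compatible (R : realType) (T : Type) k (c c' : chart R T k) : Prop :=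
  smooth_on (chart_cod c `&` param c @^-1` chart_dom c') (coords c' \o param c).

Record smoothManifold (R : realType) (k : nat) := SmoothManifold {
  mcarrier :> topologicalType;
  atlas : set (chart R mcarrier k);
  _ : hausdorff_space mcarrier;
  _ : @second_countable mcarrier;
  _ : forall c, atlas c -> is_chart c;
  _ : forall x : mcarrier, exists2 c, atlas c & chart_dom c x;
  _ : forall c c', atlas c -> atlas c' -> compatible c c' }.
Arguments atlas {R k} s.

(* The smooth structure of the open interval I, as an open subset of R. *)
Definition interval_atlas (R : realType) (I : set R) : set (chart R R 1) :=
  [set Chart I [set u : 'rV[R]_1 | I (u 0 0)]
         (fun t => const_mx t) (fun u => u 0 0)].

Definition prod_chart (R : realType) (T1 T2 : Type) (k1 k2 : nat)
    (c1 : chart R T1 k1) (c2 : chart R T2 k2) : chart R (T1 * T2) (k1 + k2) :=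
  Chart (chart_dom c1 `*` chart_dom c2)
        [set u | chart_cod c1 (lsubmx u) /\ chart_cod c2 (rsubmx u)]
        (fun x => row_mx (coords c1 x.1) (coords c2 x.2))
        (fun u => (param c1 (lsubmx u), param c2 (rsubmx u))).

Definition prod_atlas (R : realType) (T1 T2 : Type) (k1 k2 : nat)
    (A1 : set (chart R T1 k1)) (A2 : set (chart R T2 k2)) :
    set (chart R (T1 * T2) (k1 + k2)) :=
  [set prod_chart c1 c2 | c1 in A1 & c2 in A2].

Definition partial (R : realType) (k : nat) (W : normedModType R)
    (a : 'I_k) (F : 'rV[R]_k -> W) : 'rV[R]_k -> W := 'D_(delta_mx 0 a) F.

Section LocalGeometry.
Variables (R : realType) (k m : nat) (F : 'rV[R]_k -> 'M[R]_(2, m)).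
Implicit Type u : 'rV[R]_k.

Definition first_form u : 'M[R]_k :=
  \matrix_(a, b) inner (partial a F u) (partial b F u).

(* The component of w normal to F inside the unit sphere: remove the radial
   part along F u and the part tangent to F, expressed through the inverse of
   the first fundamental form.  The two directions are orthogonal to each
   other since F takes values in the unit sphere. *)
Definition normal_part u (w : 'M[R]_(2, m)) : 'M[R]_(2, m) :=
  w - inner w (F u) *: F u
    - \sum_(a < k) \sum_(b < k)
        (invmx (first_form u) a b * inner w (partial a F u)) *: partial b F u.

Definition second_form u (a b : 'I_k) : 'M[R]_(2, m) :=
  normal_part u (partial a (partial b F) u).

(* The trace of the second fundamental form, not divided by k. *)
Definition mean_curvature u : 'M[R]_(2, m) :=
  \sum_(a < k) \sum_(b < k) invmx (first_form u) a b *: second_form u a b.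

End LocalGeometry.

(* Below, A is the atlas of the source manifold of f; the sphere is seen as a
   subset of the ambient Euclidean space. *)
Section SphereMaps.
Variables (R : realType) (T : Type) (k m : nat).
Variables (A : set (chart R T k)) (f : T -> 'M[R]_(2, m)).

Definition sphere_immersion : Prop :=
  forall c, A c ->
    [/\ forall x, chart_dom c x -> usphere (f x),
        smooth_on (chart_cod c) (f \o param c) &
        forall u v, chart_cod c u -> 'D_v (f \o param c) u = 0 -> v = 0].

Definition C_totally_real : Prop :=
  forall c u v, A c -> chart_cod c u ->
    inner (mulJ (f (param c u))) ('D_v (f \o param c) u) = 0.

Definition is_minimal : Prop :=
  forall c u, A c -> chart_cod c u -> mean_curvature (f \o param c) u = 0.

End SphereMaps.

Section Geodesics.
Variable R : realType.

(* [g p v w] is the value of the metric on vectors v, w tangent to S^3 at p. *)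
Implicit Type g : 'M[R]_(2, 2) -> 'M[R]_(2, 2) -> 'M[R]_(2, 2) -> R.

Definition christoffel (k : nat) (h : 'rV[R]_k -> 'M[R]_k) (u : 'rV[R]_k)
    (a b l : 'I_k) : R :=
  2^-1 * \sum_(d < k) invmx (h u) l d *
    (partial a (fun x => h x b d) u + partial b (fun x => h x a d) u
     - partial d (fun x => h x a b) u).

Definition geodesic_equation (k : nat) (h : 'rV[R]_k -> 'M[R]_k)
    (c : R -> 'rV[R]_k) (s : R) : Prop :=
  forall l : 'I_k,
    derive1 (derive1 c) s 0 l
    + \sum_(a < k) \sum_(b < k)
        christoffel h (c s) a b l * derive1 c s 0 a * derive1 c s 0 b = 0.

(* A local parametrization of S^3.  As the dimensions agree, such a psi is a
   diffeomorphism from U onto an open subset of S^3. *)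
Definition S3_parametrization (U : set 'rV[R]_3)
    (psi : 'rV[R]_3 -> 'M[R]_(2, 2)) : Prop :=
  [/\ open U, smooth_on U psi,
      forall u, U u -> usphere (psi u),
      forall u u', U u -> U u' -> psi u = psi u' -> u = u' &
      forall u v, U u -> 'D_v psi u = 0 -> v = 0].

Definition metric_in_coords g (psi : 'rV[R]_3 -> 'M[R]_(2, 2))
    (u : 'rV[R]_3) : 'M[R]_3 :=
  \matrix_(a, b) g (psi u) (partial a psi u) (partial b psi u).

(* Meaningful when g is nondegenerate along sigma: sigma satisfies the
   geodesic equation in local coordinates around each of its points. *)
Definition geodesic_S3 g (J : set R) (sigma : R -> 'M[R]_(2, 2)) : Prop :=
  forall s, J s -> exists U psi N c,
    [/\ S3_parametrization U psi, open N /\ N s, smooth_on N c &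
        forall r, N r ->
          [/\ U (c r), sigma r = psi (c r) &
              geodesic_equation (metric_in_coords g psi) c r]].

(* gamma becomes a geodesic after composition with a diffeomorphism
   tau : J -> I of open intervals. *)
Definition unparametrized_geodesic_S3 g (I : set R)
    (gamma : R -> 'M[R]_(2, 2)) : Prop :=
  exists (J : set R) (tau : R -> R),
    [/\ open J /\ is_interval J, smooth_on J tau,
        forall s, J s -> derive1 tau s != 0,
        tau @` J = I &
        geodesic_S3 g J (gamma \o tau)].

(* |z_1|^(2 k1) |z_2|^(2 k2) g_{S^3}, the round metric being induced by the
   ambient inner product. *)
Definition weighted_metric (k1 k2 : nat) (p v w : 'M[R]_(2, 2)) : R :=
  inner (col 0 p) (col 0 p) ^+ k1 * inner (col 1 p) (col 1 p) ^+ k2 * inner v w.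

End Geodesics.

Definition spiral_product (R : realType) (T1 T2 : Type) (m1 m2 : nat)
    (gamma : R -> 'M[R]_(2, 2)) (f1 : T1 -> 'M[R]_(2, m1))
    (f2 : T2 -> 'M[R]_(2, m2)) (p : R * (T1 * T2)) : 'M[R]_(2, m1 + m2) :=
  row_mx (cscale (col 0 (gamma p.1)) (f1 p.2.1))
         (cscale (col 1 (gamma p.1)) (f2 p.2.2)).

(* Main.v *)
Require Import Defs.
From HB Require Import structures.
From mathcomp Require Import all_boot all_order all_algebra.
From mathcomp Require Import all_classical all_reals all_analysis.
From mathcomp Require Import ring lra.
Import Order.TTheory GRing.Theory Num.Theory.
Import numFieldNormedType.Exports.
Local Open Scope ring_scope.
Local Open Scope classical_set_scope.

(** The mean curvature is the normal part of the metric trace [T] of the Hessian,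
so a map [F] into the sphere is minimal at a point exactly when [T] lies in the
real span of [F] and its tangent space ([mean_curvature_eq0P]).  This condition
is linear and can be solved by taking products.

For a spiral product [(z_1 f_1, z_2 f_2)] the totally real conditions make the
curve direction and the two factors mutually orthogonal, so the inverse metric
is block diagonal and
[T = (|g'|^-2 z_i'' f_i + |z_i|^-2 z_i T_i)_i], where [g = (z_1, z_2)] and [T_i]
is the Hessian trace of [f_i] ([frame_trace_spiral]).  The position, velocity
and tangent vectors are [(z_i f_i)_i], [(z_i' f_i)_i], [(z_i X_i)_i].
Differentiating [<f_i, f_i> = 1] and the totally real condition shows that the
Hermitian product of [T_i] with [f_i] is [- k_i], while that of a tangent vector
[X_i] is 0.  Hence Hermitian products with [f_1] and [f_2] turn the span
condition into [|g'|^-2 g'' - K(g) \in span (g, g')], with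
[K = (k_i z_i / |z_i|^2)_i], and what remains says that each [T_i] lies in the
span of [f_i] and its tangent space, that is, that [f_i] is minimal
([spiral_span], [spiral_mean_curvature_eq0P]).

The weight [W = |z_1|^(2 k1) |z_2|^(2 k2)] has gradient [2 W K].  Lowering the
index of the geodesic equation of [W g_S3] in any chart [psi] gives
orthogonality of [s'' + 2 <K, s'> s' - |s'|^2 K] to the coordinate frame of
[psi], so that this vector is radial ([geodesic_equation_weightedP]); the
symmetry of second derivatives of [psi] ([derive_comm_mx]) is used there.  Modulo
the velocity this is the condition on [g] above, which is invariant under
reparametrization.  Conversely a curve with that condition can be parametrized
at unit speed for [W g_S3] ([unit_speed_parameter]); then the constancy of
[W |s'|^2] fixes the tangential acceleration, and the geodesic equation holds in
stereographic charts centred at the points of the curve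
([unparametrized_geodesicP]).  *)

Set Implicit Arguments.
Unset Strict Implicit.
Unset Printing Implicit Defensive.

Local Notation cscale := Defs.cscale.

(** * Complex scaling and inner products *)

Lemma ord2P (i : 'I_2) : {i = 0} + {i = 1}.
Proof.
case: (unliftP 0 i) => [k|] ->; [right|by left].
by apply: val_inj; rewrite [k]ord1.
Qed.

Lemma sum_ord2 (V : nmodType) (F : 'I_2 -> V) : \sum_(i < 2) F i = F 0 + F 1.
Proof. by rewrite big_ord_recl big_ord1; congr (_ + F _); apply: val_inj. Qed.

Section InnerTheory.
Variables (R : realType) (m : nat).
Implicit Types (u v w : 'M[R]_(2, m)) (z : 'cV[R]_2) (a : R).

Lemma mulJ_is_linear : linear (@mulJ R m).
Proof.
move=> a v w; apply/matrixP=> i j; rewrite !mxE.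
by case: ifP => _; rewrite ?mulrN ?opprD.
Qed.

HB.instance Definition _ := GRing.isLinear.Build R 'M[R]_(2, m) 'M[R]_(2, m) _
  (@mulJ R m) mulJ_is_linear.

Lemma innerE v w : inner v w = \sum_(j < m) (v 0 j * w 0 j + v 1 j * w 1 j).
Proof. by rewrite /inner exchange_big; apply: eq_bigr => j _; rewrite sum_ord2. Qed.

Lemma innerC v w : inner v w = inner w v.
Proof. by apply: eq_bigr=> i _; apply: eq_bigr=> j _; rewrite mulrC. Qed.

Lemma inner_linearP w a u v : inner (a *: u + v) w = a * inner u w + inner v w.
Proof.
rewrite /inner mulr_sumr -big_split; apply: eq_bigr => i _ /=.
rewrite mulr_sumr -big_split; apply: eq_bigr => j _ /=.
by rewrite !mxE; ring.
Qed.

Lemma innerDl u v w : inner (u + v) w = inner u w + inner v w.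
Proof. by rewrite -[u]scale1r inner_linearP mul1r scale1r. Qed.
Lemma inner0l w : inner 0 w = 0.
Proof. by apply: big1 => i _; apply: big1=> j _; rewrite mxE mul0r. Qed.
Lemma innerZl a u w : inner (a *: u) w = a * inner u w.
Proof. by rewrite -[a *: u]addr0 inner_linearP inner0l addr0. Qed.
Lemma innerNl u w : inner (- u) w = - inner u w.
Proof. by rewrite -scaleN1r innerZl mulN1r. Qed.
Lemma innerBl u v w : inner (u - v) w = inner u w - inner v w.
Proof. by rewrite innerDl innerNl. Qed.
Lemma inner_suml (T : Type) (r : seq T) (P : pred T) (F : T -> 'M[R]_(2, m)) w :
  inner (\sum_(i <- r | P i) F i) w = \sum_(i <- r | P i) inner (F i) w.
Proof. exact: (big_morph (fun v => inner v w) (fun u v => innerDl u v w) (inner0l w)). Qed.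

Lemma innerDr u v w : inner w (u + v) = inner w u + inner w v.
Proof. by rewrite innerC innerDl !(innerC w). Qed.
Lemma inner0r w : inner w 0 = 0. Proof. by rewrite innerC inner0l. Qed.
Lemma innerZr a u w : inner w (a *: u) = a * inner w u.
Proof. by rewrite innerC innerZl innerC. Qed.
Lemma inner_sumr (T : Type) (r : seq T) (P : pred T) (F : T -> 'M[R]_(2, m)) w :
  inner w (\sum_(i <- r | P i) F i) = \sum_(i <- r | P i) inner w (F i).
Proof. by rewrite innerC inner_suml; apply: eq_bigr => i _; rewrite innerC. Qed.

Lemma inner_ge0 v : 0 <= inner v v.
Proof. by apply: sumr_ge0 => i _; apply: sumr_ge0=> j _; rewrite -expr2 sqr_ge0. Qed.

Lemma inner_eq0 v : (inner v v == 0) = (v == 0).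
Proof.
apply/idP/eqP => [|->]; last by rewrite inner0l.
rewrite psumr_eq0 => [/allP h|i _]; last first.
  by apply: sumr_ge0 => j _; rewrite -expr2 sqr_ge0.
apply/matrixP => i j; rewrite mxE; apply/eqP; rewrite -sqrf_eq0 expr2.
move: (h i (mem_index_enum _)); rewrite /= psumr_eq0; last by move=> k _; rewrite -expr2 sqr_ge0.
by move=> /allP /(_ j (mem_index_enum _)).
Qed.

Lemma inner_gt0 v : (0 < inner v v) = (v != 0).
Proof. by rewrite lt_def inner_ge0 andbT inner_eq0. Qed.

Lemma inner_JJ v w : inner (mulJ v) (mulJ w) = inner v w.
Proof. by rewrite !innerE; apply: eq_bigr=> j _; rewrite !mxE /=; ring. Qed.

Lemma inner_Jl v w : inner (mulJ v) w = - inner v (mulJ w).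
Proof. by rewrite !innerE -sumrN; apply: eq_bigr=> j _; rewrite !mxE /=; ring. Qed.

Lemma inner_Jv v : inner (mulJ v) v = 0.
Proof. by have := inner_Jl v v; rewrite (innerC v); lra. Qed.

Lemma cscale_is_linear z : linear (@cscale R m z).
Proof.
by move=> a v w; apply/matrixP=> i j; rewrite !mxE; case: ifP => _; ring.
Qed.

HB.instance Definition _ z := GRing.isLinear.Build R 'M[R]_(2, m) 'M[R]_(2, m) _
  (@cscale R m z) (cscale_is_linear z).

Lemma cscaleDr z v w : cscale z (v + w) = cscale z v + cscale z w.
Proof. exact: linearD. Qed.
Lemma cscale0r z : cscale z (0 : 'M[R]_(2, m)) = 0.
Proof. exact: linear0. Qed.
Lemma cscaleZr z a w : cscale z (a *: w) = a *: cscale z w.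
Proof. exact: linearZ. Qed.
Lemma cscale_sumr z (I : finType) (F : I -> 'M[R]_(2, m)) :
  cscale z (\sum_i F i) = \sum_i cscale z (F i).
Proof. exact: linear_sum. Qed.

Lemma cscale_linearl w a z z' :
  cscale (a *: z + z') w = a *: cscale z w + cscale z' w.
Proof.
by apply/matrixP=> i j; rewrite !mxE; case: ifP => _; ring.
Qed.
Lemma cscaleDl w z z' : cscale (z + z') w = cscale z w + cscale z' w.
Proof. by rewrite -[z]scale1r cscale_linearl !scale1r. Qed.
Lemma cscale0l w : cscale 0 w = 0.
Proof. by apply/matrixP=> i j; rewrite !mxE; case: ifP => _; ring. Qed.
Lemma cscaleZl w a z : cscale (a *: z) w = a *: cscale z w.
Proof. by rewrite -[a *: z]addr0 cscale_linearl cscale0l addr0. Qed.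

End InnerTheory.

Section HermitianTheory.
Variables (R : realType) (m : nat).
Implicit Types (v w f : 'M[R]_(2, m)) (z : 'cV[R]_2) (a : R).

Lemma inner_cscale z v w :
  inner (cscale z v) (cscale z w) = inner z z * inner v w.
Proof.
rewrite /cscale !(innerDl, innerDr, innerZl, innerZr) inner_JJ inner_Jl.
by rewrite [inner z z]innerE big_ord1; ring.
Qed.

(** The Hermitian product of [w] and [f], complex linear in [w]: its imaginary
part is the real product with [i f]. *)
Definition cinner (w f : 'M[R]_(2, m)) : 'cV[R]_2 :=
  \matrix_(i, j) (if i == 0 then inner w f else inner w (mulJ f)).

Lemma cinner_linearl f a v w :
  cinner (a *: v + w) f = a *: cinner v f + cinner w f.
Proof. by apply/matrixP=> i j; rewrite !mxE; case: ifP; rewrite inner_linearP. Qed.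

Lemma cinnerDl f v w : cinner (v + w) f = cinner v f + cinner w f.
Proof. by rewrite -[v]scale1r cinner_linearl !scale1r. Qed.

Lemma cinner0l f : cinner 0 f = 0.
Proof. by apply/matrixP=> i j; rewrite !mxE !inner0l if_same. Qed.

Lemma cinnerZl f a w : cinner (a *: w) f = a *: cinner w f.
Proof. by rewrite -[a *: w]addr0 cinner_linearl cinner0l addr0. Qed.

Lemma cinner_cscale z w f :
  cinner (cscale z w) f = cscale z (cinner w f).
Proof.
apply/matrixP=> i j; case: (ord2P i) => ->.
  by rewrite !mxE /= innerDl !innerZl inner_Jl.
by rewrite !mxE /= innerDl !innerZl inner_JJ.
Qed.

Lemma cinner0 w f : inner w f = 0 -> inner w (mulJ f) = 0 -> cinner w f = 0.
Proof. by move=> h1 h2; apply/matrixP => i j; rewrite !mxE h1 h2 if_same. Qed.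

(** With [inner f f = 1] and [w = f] this recovers the coefficient [z] of a complex
multiple of [f]. *)
Lemma cinner_cscale_real c z w f :
  inner w f = c -> inner w (mulJ f) = 0 -> cinner (cscale z w) f = c *: z.
Proof.
move=> wf wJf; rewrite cinner_cscale; apply/matrixP=> i j.
rewrite [j]ord1; case: (ord2P i) => ->; rewrite !mxE /= wf wJf; ring.
Qed.

Lemma inner_row_mx m2 v w (v' w' : 'M[R]_(2, m2)) :
  inner (row_mx v v') (row_mx w w') = inner v w + inner v' w'.
Proof.
rewrite /inner -big_split; apply: eq_bigr => i _ /=.
rewrite big_split_ord; congr (_ + _); apply: eq_bigr => j _ /=.
  by rewrite !row_mxEl.
by rewrite !row_mxEr.
Qed.

Lemma cscale_inj z : z != 0 -> injective (@cscale R m z).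
Proof.
move=> z0 v w /eqP; rewrite -subr_eq0 -linearB -inner_eq0 inner_cscale.
by rewrite mulf_eq0 !inner_eq0 (negbTE z0) subr_eq0 => /eqP.
Qed.

End HermitianTheory.

(** * Directional derivatives *)

Section DerivativeRules.
Variables (R : realType) (V : normedModType R).
Implicit Types (x v : V).

Lemma is_derive_mxP m n (F : V -> 'M[R]_(m, n)) dF x v :
  is_derive x v F dF <->
  forall i j, is_derive x v (fun y => F y i j) (dF i j).
Proof.
split=> [[dFx <-] i j|h].
  split; first by move/derivable_mxP: dFx; exact.
  by rewrite derive_mx// mxE.
have dF' : derivable F x v by apply/derivable_mxP => i j; case: (h i j).
split=> //; rewrite derive_mx//; apply/matrixP=> i j; rewrite mxE.
by case: (h i j).
Qed.

Lemma is_derive_prod (f g : V -> R) x v df dg :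
  is_derive x v f df -> is_derive x v g dg ->
  is_derive x v (fun y => f y * g y) (df * g x + f x * dg).
Proof.
move=> hf hg; apply: is_derive_eq (is_deriveM hf hg) _.
by rewrite addrC /GRing.scale /= [g x * _]mulrC.
Qed.

Lemma is_derive_sumf (W : normedModType R) n (h : 'I_n -> V -> W) x v dh :
  (forall i, is_derive x v (h i) (dh i)) ->
  is_derive x v (fun y => \sum_(i < n) h i y) (\sum_(i < n) dh i).
Proof.
move=> hh; have := is_derive_sum hh.
by congr is_derive; apply/funext => y; rewrite fct_sumE.
Qed.

Lemma is_derive_plus (W : normedModType R) (f g : V -> W) x v df dg :
  is_derive x v f df -> is_derive x v g dg ->
  is_derive x v (fun y => f y + g y) (df + dg).
Proof. exact: is_deriveD. Qed.

Lemma is_derive_inner m (F G : V -> 'M[R]_(2, m)) x v dF dG :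
  is_derive x v F dF -> is_derive x v G dG ->
  is_derive x v (fun y => inner (F y) (G y)) (inner dF (G x) + inner (F x) dG).
Proof.
move=> /is_derive_mxP hF /is_derive_mxP hG.
rewrite /inner -big_split /=; apply: is_derive_sumf => i.
rewrite -big_split /=; apply: is_derive_sumf => j.
exact: is_derive_prod.
Qed.

Lemma is_derive_scalef m n (a : V -> R) (F : V -> 'M[R]_(m, n)) x v da dF :
  is_derive x v a da -> is_derive x v F dF ->
  is_derive x v (fun y => a y *: F y) (da *: F x + a x *: dF).
Proof.
move=> ha /is_derive_mxP hF; apply/is_derive_mxP => i j.
have -> : (fun y => (a y *: F y) i j) = (fun y => a y * F y i j).
  by apply/funext=> y; rewrite mxE.
by rewrite !mxE; exact: is_derive_prod.
Qed.

Lemma is_derive_mulJ m (F : V -> 'M[R]_(2, m)) x v dF :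
  is_derive x v F dF -> is_derive x v (fun y => mulJ (F y)) (mulJ dF).
Proof.
move=> /is_derive_mxP hF; apply/is_derive_mxP => i j.
have -> : (fun y => mulJ (F y) i j) =
    (fun y => if i == 0 then - F y 1 j else F y 0 j).
  by apply/funext=> y; rewrite mxE.
by rewrite mxE; case: ifP => _; [exact: is_deriveN|exact: hF].
Qed.

Lemma is_derive_col m n (F : V -> 'M[R]_(m, n)) j x v dF :
  is_derive x v F dF -> is_derive x v (fun y => col j (F y)) (col j dF).
Proof.
move=> /is_derive_mxP hF; apply/is_derive_mxP => i k.
have -> : (fun y => col j (F y) i k) = (fun y => F y i j).
  by apply/funext=> y; rewrite mxE.
by rewrite mxE; exact: hF.
Qed.

Lemma is_derive_cscale m (z : V -> 'cV[R]_2) (F : V -> 'M[R]_(2, m)) x v dz dF :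
  is_derive x v z dz -> is_derive x v F dF ->
  is_derive x v (fun y => cscale (z y) (F y)) (cscale dz (F x) + cscale (z x) dF).
Proof.
move=> /is_derive_mxP hz hF; rewrite /cscale addrACA.
apply: is_derive_plus; apply: is_derive_scalef => //.
exact: is_derive_mulJ.
Qed.

Lemma is_derive_row_mx m n1 n2 (F : V -> 'M[R]_(m, n1)) (G : V -> 'M[R]_(m, n2))
    x v dF dG :
  is_derive x v F dF -> is_derive x v G dG ->
  is_derive x v (fun y => row_mx (F y) (G y)) (row_mx dF dG).
Proof.
move=> /is_derive_mxP hF /is_derive_mxP hG; apply/is_derive_mxP => i j.
case: (split_ordP j) => k ->.
  have -> : (fun y => row_mx (F y) (G y) i (lshift n2 k)) = (fun y => F y i k).
    by apply/funext => y; rewrite row_mxEl.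
  by rewrite row_mxEl.
have -> : (fun y => row_mx (F y) (G y) i (rshift n1 k)) = (fun y => G y i k).
  by apply/funext => y; rewrite row_mxEr.
by rewrite row_mxEr.
Qed.

(** A directional derivative only sees the restriction to a line, so
precomposing with a linear map needs no regularity. *)
Lemma derive_comp_linear (V' W : normedModType R) (L : {linear V' -> V})
    (g : V -> W) (x v : V') :
  'D_v (g \o L) x = 'D_(L v) g (L x).
Proof.
rewrite /derive; set p := (fun h : R => _); set q := (fun h : R => _).
by have -> : p = q by apply/funext => h; rewrite /p /q /= linearP.
Qed.

Lemma derivable_comp_linear (V' W : normedModType R) (L : {linear V' -> V})
    (g : V -> W) (x v : V') :
  derivable g (L x) (L v) -> derivable (g \o L) x v.
Proof.
rewrite /derivable; set p := (fun h : R => _); set q := (fun h : R => _).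
by have -> : p = q by apply/funext => h; rewrite /p /q /= linearP.
Qed.

Lemma is_derive_comp_linear (V' W : normedModType R) (L : {linear V' -> V})
    (g : V -> W) (x v : V') dg :
  is_derive (L x) (L v) g dg -> is_derive x v (fun y => g (L y)) dg.
Proof.
move=> [d <-]; split; first exact: derivable_comp_linear.
by rewrite -derive_comp_linear.
Qed.

Lemma is_derive_comp (V' W : normedModType R) (c : V' -> V) (g : V -> W)
    (x v : V') :
  differentiable c x -> differentiable g (c x) ->
  is_derive x v (fun y => g (c y)) ('D_('D_v c x) g (c x)).
Proof.
move=> dc dg; have dgc : differentiable (g \o c) x by exact: differentiable_comp.
split; first exact: diff_derivable.
by rewrite -[LHS]/('D_v (g \o c) x) !deriveE// diff_comp.
Qed.

End DerivativeRules.

Lemma derive_real_dir (R : realType) (W : normedModType R) (f : R -> W) t a :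
  differentiable f t -> 'D_a f t = a *: 'D_1 f t.
Proof.
by move=> df; rewrite !deriveE// -[in LHS](mulr1 a) -[RHS]linearZ.
Qed.

(** Differentiability enters here: it makes directional derivatives linear in the
direction. *)
Lemma derive_partial (R : realType) (W : normedModType R) k
    (f : 'rV[R]_k -> W) (u v : 'rV[R]_k) :
  differentiable f u -> 'D_v f u = \sum_(a < k) v 0 a *: partial a f u.
Proof.
move=> df; rewrite [v in LHS]row_sum_delta deriveE// linear_sum.
by apply: eq_bigr => a _; rewrite linearZ /= /partial deriveE.
Qed.

(** * Mean curvature and the trace of the Hessian *)

Section SmoothBasics.
Variables (R : realType) (V W : normedModType R).
Implicit Types (O : set V) (f : V -> W).

Lemma smooth_on_diff O f x : smooth_on O f -> O x -> differentiable f x.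
Proof. by move=> sf Ox; have /= [df _] := sf 1%N; exact: df. Qed.

Lemma smooth_on_derive O f v : smooth_on O f -> smooth_on O ('D_v f).
Proof. by move=> sf n; have /= [_] := sf n.+1; exact. Qed.

Lemma smooth_on_is_derive O f x v :
  smooth_on O f -> O x -> is_derive x v f ('D_v f x).
Proof. by move=> sf Ox; split=> //; apply: diff_derivable; exact: smooth_on_diff sf Ox. Qed.

Lemma derive_cst_on O f x v c d : open O -> O x -> (forall y, O y -> f y = c) ->
  is_derive x v f d -> d = 0.
Proof.
move=> oO Ox fc [_ <-].
have fcx : \near x, f x = cst c x.
  by near=> y; apply: fc; near: y; exact: open_nbhs_nbhs.
by rewrite (near_eq_derive v fcx) derive_cst.
Unshelve. all: by end_near. Qed.

End SmoothBasics.

Lemma derive_eq_on (R : realType) (V W : normedModType R) (O : set V)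
    (f g : V -> W) x v :
  open O -> O x -> (forall y, O y -> f y = g y) -> 'D_v f x = 'D_v g x.
Proof.
move=> oO Ox fg; apply: near_eq_derive.
by near=> y; apply: fg; near: y; exact: open_nbhs_nbhs.
Unshelve. all: by end_near. Qed.

Lemma smooth_on_cst (R : realType) (V W : normedModType R) (O : set V) (c : W) :
  smooth_on O (fun=> c).
Proof.
move=> n; elim: n c => [|n IHn] c /=; first by move=> x _; exact: cst_continuous.
split=> [x _|v]; first exact: differentiable_cst.
have -> : 'D_v (fun=> c) = (fun=> 0) :> (V -> W) by apply/funext => x; rewrite derive_cst.
exact: IHn.
Qed.

(** The pointwise linear algebra of mean curvature: [X] is a frame tangent to
the sphere at [p] and [H a b] stands for second derivatives.  For
[X a = partial a F u] and [p = F u], [gram X] and [frame_normal p X] are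
convertible to [first_form F u] and [normal_part F u]. *)
Section FrameAlgebra.
Variables (R : realType) (k m : nat).
Variables (p : 'M[R]_(2, m)) (X : 'I_k -> 'M[R]_(2, m)).
Variable H : 'I_k -> 'I_k -> 'M[R]_(2, m).

Definition gram : 'M[R]_k := \matrix_(a, b) inner (X a) (X b).

Definition frame_trace : 'M[R]_(2, m) :=
  \sum_(a < k) \sum_(b < k) invmx gram a b *: H a b.

Definition frame_span (w : 'M[R]_(2, m)) : Prop :=
  exists (a : R) (b : 'I_k -> R), w = a *: p + \sum_(i < k) b i *: X i.

Definition frame_normal (w : 'M[R]_(2, m)) : 'M[R]_(2, m) :=
  w - inner w p *: p
    - \sum_(a < k) \sum_(b < k) (invmx gram a b * inner w (X a)) *: X b.

Lemma frame_normal_is_linear : linear frame_normal.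
Proof.
move=> c v w; rewrite /frame_normal scalerBr scalerBr.
rewrite inner_linearP scalerDl -scalerA.
have -> : \sum_(a < k) \sum_(b < k)
    (invmx gram a b * inner (c *: v + w) (X a)) *: X b
  = c *: (\sum_(a < k) \sum_(b < k) (invmx gram a b * inner v (X a)) *: X b)
   + \sum_(a < k) \sum_(b < k) (invmx gram a b * inner w (X a)) *: X b.
  rewrite scaler_sumr -big_split; apply: eq_bigr => a _ /=.
  rewrite scaler_sumr -big_split; apply: eq_bigr => b _ /=.
  by rewrite inner_linearP scalerA -scalerDl; congr (_ *: _); ring.
set A := c *: v; set B := c *: (inner v _ *: _); set C := c *: (\sum_(a < k) _).
by apply/matrixP => i j; rewrite !mxE; ring.
Qed.

HB.instance Definition _ := GRing.isLinear.Build R 'M[R]_(2, m) 'M[R]_(2, m) _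
  frame_normal frame_normal_is_linear.

Lemma frame_normal_trace :
  \sum_(a < k) \sum_(b < k) invmx gram a b *: frame_normal (H a b)
  = frame_normal frame_trace.
Proof.
rewrite /frame_trace linear_sum; apply: eq_bigr => a _.
by rewrite linear_sum; apply: eq_bigr => b _; rewrite linearZ.
Qed.

(** [v *m gram *m v^T] is the squared length of [\sum_a v_a X_a], so a null vector
of [gram] is a linear relation in the frame. *)
Lemma gram_unit :
  (forall v : 'rV[R]_k, \sum_(a < k) v 0 a *: X a = 0 -> v = 0) ->
  gram \in unitmx.
Proof.
move=> X_free; rewrite -row_free_unit -kermx_eq0; apply/rowV0P => v.
move=> /sub_kermxP vG; apply: X_free; apply/eqP; rewrite -inner_eq0.
rewrite inner_suml big1// => a _; rewrite innerZl inner_sumr.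
have /matrixP /(_ 0 a) := vG; rewrite !mxE => vGa.
rewrite (eq_bigr (fun b => v 0 b * gram b a)) ?vGa ?mulr0// => b _.
by rewrite mxE innerZr (innerC (X b)).
Qed.

Lemma inv_gram_sym a b : invmx gram a b = invmx gram b a.
Proof.
have gramT : gram^T = gram.
  by apply/matrixP => i j; rewrite !mxE (innerC (X i)).
by rewrite -[in LHS]gramT -trmx_inv mxE.
Qed.

Hypothesis p_unit : inner p p = 1.
Hypothesis X_tangent : forall a, inner p (X a) = 0.
Hypothesis X_gram_unit : gram \in unitmx.

Lemma frame_normal_radial : frame_normal p = 0.
Proof.
rewrite /frame_normal p_unit scale1r subrr sub0r big1 ?oppr0// => a _.
by rewrite big1// => b _; rewrite X_tangent mulr0 scale0r.
Qed.

Lemma frame_normal_tangent c : frame_normal (X c) = 0.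
Proof.
rewrite /frame_normal innerC X_tangent scale0r subr0 exchange_big /=.
rewrite (eq_bigr (fun b => (c == b)%:R *: X b)); last first.
  move=> b _; rewrite -scaler_suml; congr (_ *: _).
  have /matrixP /(_ c b) := mulmxV X_gram_unit; rewrite !mxE => <-.
  by apply: eq_bigr => a _; rewrite mxE mulrC.
rewrite (bigD1 c)//= eqxx scale1r big1 ?addr0 ?subrr// => b bc.
by rewrite eq_sym (negbTE bc) scale0r.
Qed.

Lemma frame_normal_eq0P w : frame_normal w = 0 <-> frame_span w.
Proof.
split=> [|[a [b ->]]]; last first.
  rewrite linearD linearZ /= frame_normal_radial scaler0 add0r linear_sum big1//.
  by move=> i _; rewrite linearZ /= frame_normal_tangent scaler0.
rewrite /frame_normal => /eqP.
rewrite -addrA -opprD subr_eq0 => /eqP wE.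
exists (inner w p), (fun b => \sum_(a < k) invmx gram a b * inner w (X a)).
rewrite [LHS]wE; congr (_ + _); rewrite exchange_big; apply: eq_bigr => b _ /=.
by rewrite -scaler_suml.
Qed.

(** A unit vector field has Hessian [- gram] in its own direction, whose
metric trace is minus the dimension. *)
Lemma frame_trace_radial :
  (forall a b, inner p (H a b) = - inner (X a) (X b)) ->
  inner frame_trace p = - k%:R.
Proof.
move=> pH; rewrite innerC /frame_trace inner_sumr.
rewrite -[k%:R](@mxtrace1 R) -(mulVmx X_gram_unit) /mxtrace -sumrN.
apply: eq_bigr => a _; rewrite inner_sumr mxE -sumrN.
apply: eq_bigr => b _; rewrite innerZr pH mulrN mxE.
by rewrite (innerC (X a)).
Qed.

(** Differentiating the totally real condition makes the [i p]-component of
the Hessian skew in the two directions, hence killed by the symmetric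
trace. *)
Lemma frame_trace_Jradial :
  (forall a b, inner (mulJ p) (H a b) = - inner (mulJ (X a)) (X b)) ->
  inner frame_trace (mulJ p) = 0.
Proof.
move=> pH; rewrite innerC; set S := inner _ _.
suff SN : S = - S by apply/eqP; have := SN; lra.
rewrite /S /frame_trace inner_sumr.
rewrite (eq_bigr (fun a => \sum_b inner (mulJ p) (invmx gram a b *: H a b))).
  2: by move=> a _; rewrite inner_sumr.
rewrite {1}exchange_big -sumrN; apply: eq_bigr => a _ /=.
rewrite -sumrN; apply: eq_bigr => b _ /=.
rewrite !innerZr inv_gram_sym !pH (inner_Jl (X a)) (innerC (X a)).
by rewrite !opprK mulrN.
Qed.

End FrameAlgebra.

Section MeanCurvature.
Variables (R : realType) (k m : nat) (F : 'rV[R]_k -> 'M[R]_(2, m)).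
Implicit Type u : 'rV[R]_k.

Definition coord_frame u (a : 'I_k) := partial a F u.

Definition coord_hessian u (a b : 'I_k) := partial a (partial b F) u.

Definition hessian_trace u := frame_trace (coord_frame u) (coord_hessian u).

Lemma first_form_unit u : differentiable F u ->
  (forall v, 'D_v F u = 0 -> v = 0) -> gram (coord_frame u) \in unitmx.
Proof.
move=> dF immF; apply: gram_unit => v; rewrite -derive_partial//; exact: immF.
Qed.

(** The mean curvature is the normal component of the metric trace of the
Hessian, so it vanishes exactly when that trace lies in the span of the
position vector and the tangent space.  This form makes no reference to the
projection and is linear in the data. *)
Lemma mean_curvature_eq0P u : inner (F u) (F u) = 1 ->
  (forall a, inner (F u) (coord_frame u a) = 0) ->
  gram (coord_frame u) \in unitmx ->
  mean_curvature F u = 0 <-> frame_span (F u) (coord_frame u) (hessian_trace u).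
Proof.
move=> p1 pX gX; rewrite -(frame_normal_eq0P p1 pX gX).
rewrite /hessian_trace -frame_normal_trace; reflexivity.
Qed.

End MeanCurvature.

Section SphereMapLocal.
Variables (R : realType) (k m : nat) (F : 'rV[R]_k -> 'M[R]_(2, m)).
Variable O : set 'rV[R]_k.
Hypotheses (openO : open O) (smoothF : smooth_on O F).
Hypothesis F_sphere : forall y, O y -> inner (F y) (F y) = 1.

Lemma sphere_orth_derive u v : O u -> inner (F u) ('D_v F u) = 0.
Proof.
move=> Ou; have hF := smooth_on_is_derive v smoothF Ou.
have := derive_cst_on openO Ou F_sphere (is_derive_inner hF hF).
by rewrite innerC -mulr2n => /eqP; rewrite mulrn_eq0 => /eqP.
Qed.

Lemma inner_hessian u v w : O u ->
  inner (F u) ('D_v ('D_w F) u) = - inner ('D_v F u) ('D_w F u).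
Proof.
move=> Ou; have hF := smooth_on_is_derive v smoothF Ou.
have hF2 := smooth_on_is_derive v (smooth_on_derive w smoothF) Ou.
have h0 y : O y -> inner (F y) ('D_w F y) = 0 by exact: sphere_orth_derive.
have /eqP := derive_cst_on openO Ou h0 (is_derive_inner hF hF2).
by rewrite addrC addr_eq0 => /eqP.
Qed.

Hypothesis F_real : forall y v, O y -> inner (mulJ (F y)) ('D_v F y) = 0.

Lemma inner_J_hessian u v w : O u ->
  inner (mulJ (F u)) ('D_v ('D_w F) u) = - inner (mulJ ('D_v F u)) ('D_w F u).
Proof.
move=> Ou; have hF := is_derive_mulJ (smooth_on_is_derive v smoothF Ou).
have hF2 := smooth_on_is_derive v (smooth_on_derive w smoothF) Ou.
have h0 y : O y -> inner (mulJ (F y)) ('D_w F y) = 0 by exact: F_real.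
have /eqP := derive_cst_on openO Ou h0 (is_derive_inner hF hF2).
by rewrite addrC addr_eq0 => /eqP.
Qed.

(** Two derivatives of [<F, F> = 1] and of the totally real condition: the Hermitian
product of the Hessian trace with [F] is the real number [- k]. *)
Lemma cinner_hessian_trace u : O u -> gram (coord_frame F u) \in unitmx ->
  inner (hessian_trace F u) (F u) = - k%:R /\
  inner (hessian_trace F u) (mulJ (F u)) = 0.
Proof.
move=> Ou gX; split.
  by apply: frame_trace_radial => // a b; exact: inner_hessian.
by apply: frame_trace_Jradial => // a b; exact: inner_J_hessian.
Qed.

End SphereMapLocal.

(** * Linear algebra of a spiral product *)

Section SpiralFactor.
Variables (R : realType) (k m : nat).
Variables (f : 'M[R]_(2, m)) (X : 'I_k -> 'M[R]_(2, m)) (T : 'M[R]_(2, m)).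
Variables (z dz a : 'cV[R]_2).
Hypothesis f_unit : inner f f = 1.
Hypothesis X_tangent : forall i, inner f (X i) = 0.
Hypothesis T_radial : inner T f = - k%:R.
Let n := inner z z.

Lemma cscale_frame_sum w (c : 'I_k -> R) :
  \sum_i c i *: cscale w (X i) = cscale w (\sum_i c i *: X i).
Proof. by rewrite cscale_sumr; apply: eq_bigr => i _; rewrite cscaleZr. Qed.

(** One complex factor of the span condition for a spiral product: [a], [z],
[dz] are the coefficients of acceleration, position and velocity, and [T] is
the Hessian trace of the factor.  If [T] lies in the span of [f] and its
tangent space, its coefficient along [f] is forced to be [- k]. *)
Lemma spiral_factor_bwd al be be' (c : 'I_k -> R) :
  T = be' *: f + \sum_i c i *: X i ->
  a - (k%:R / n) *: z = al *: z + be *: dz ->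
  exists c' : 'I_k -> R, cscale a f + cscale (n^-1 *: z) T =
    al *: cscale z f + be *: cscale dz f + \sum_i c' i *: cscale z (X i).
Proof.
move=> TE aE; exists (fun i => n^-1 * c i).
have be'E : be' = - k%:R.
  rewrite -T_radial TE innerDl innerZl f_unit mulr1 inner_suml big1 ?addr0//.
  by move=> i _; rewrite innerZl (innerC (X i)) X_tangent mulr0.
have {aE}-> : a = al *: z + be *: dz + (k%:R / n) *: z by rewrite -aE subrK.
rewrite cscale_frame_sum TE be'E !cscaleDl !cscaleZl -!addrA.
congr (_ + (_ + _)).
rewrite cscaleDr cscaleZr [n^-1 *: _]scalerDr scalerA addrA -scalerDl.
have -> : k%:R / n + n^-1 * - k%:R = 0 by ring.
rewrite scale0r add0r -cscaleZr scaler_sumr; congr (cscale z _).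
by apply: eq_bigr => i _; rewrite scalerA.
Qed.

Hypothesis X_real : forall i, inner (mulJ f) (X i) = 0.
Hypothesis T_Jradial : inner T (mulJ f) = 0.

(** The totally real condition makes [X] Hermitian orthogonal to [f], so taking
Hermitian products with [f] isolates the coefficients along [f]; what is left
is then tangent to [f], because complex multiplication by [z] is injective. *)
Lemma spiral_factor_fwd al be (c : 'I_k -> R) :
  (k = 0%N -> T = 0) -> (z = 0 -> k = 0%N) ->
  cscale a f + cscale (n^-1 *: z) T =
    al *: cscale z f + be *: cscale dz f + \sum_i c i *: cscale z (X i) ->
  a - (k%:R / n) *: z = al *: z + be *: dz /\
  exists be' (c' : 'I_k -> R), T = be' *: f + \sum_i c' i *: X i.
Proof.
move=> T0 z0; rewrite cscale_frame_sum => eqW.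
have fJf : inner f (mulJ f) = 0 by rewrite innerC inner_Jv.
have coefE : a - (k%:R / n) *: z = al *: z + be *: dz.
  have af := cinner_cscale_real a f_unit fJf.
  have zf := cinner_cscale_real z f_unit fJf.
  have dzf := cinner_cscale_real dz f_unit fJf.
  have zT := cinner_cscale_real (n^-1 *: z) T_radial T_Jradial.
  have zX : cinner (cscale z (\sum_i c i *: X i)) f = 0.
    rewrite cinner_cscale cinner0 ?cscale0r//.
      rewrite inner_suml big1// => i _.
      by rewrite innerZl (innerC (X i)) X_tangent mulr0.
    rewrite inner_suml big1// => i _.
    by rewrite innerZl (innerC (X i)) X_real mulr0.
  move: eqW af zf dzf zT zX; move: (cscale a f) (cscale z f) (cscale dz f).
  move: (cscale _ T) (cscale z _) => A B C D E eqW af zf dzf zT zX.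
  have := congr1 (fun w => cinner w f) eqW.
  rewrite !(cinnerDl, cinnerZl) af zf dzf zT zX !scale1r addr0 => <-.
  by rewrite scalerA mulNr scaleNr.
split=> //.
have [k0|kN0] := eqVneq k 0%N.
  exists 0, (fun=> 0); rewrite scale0r add0r big1 ?T0//.
  by move=> i _; rewrite scale0r.
have zN0 : z != 0 by apply: contra_neq kN0.
have nN0 : n != 0 by rewrite inner_eq0.
exists (- k%:R), (fun i => n * c i); apply: (cscale_inj zN0).
move/(canRL (subrK _)): coefE => aE; move: eqW.
rewrite aE !cscaleDl !cscaleZl -!addrA => /addrI/addrI.
move/(canRL (addKr _)) => /(congr1 (fun w => n *: w)).
rewrite scalerA mulfV// scale1r => ->.
rewrite scalerDr -scaleNr scalerA mulrN mulrCA mulfV// mulr1.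
rewrite cscaleDr cscaleZr; congr (_ + _).
rewrite -cscaleZr scaler_sumr; congr (cscale z _).
by apply: eq_bigr => i _; rewrite scalerA.
Qed.

End SpiralFactor.

(** Half the Euclidean gradient of [ln (|z_1|^(2 k1) * |z_2|^(2 k2))].  Where
[z_i] vanishes and [k_i = 0], the convention [0^-1 = 0] gives the right value. *)
Definition half_log_gradient (R : realType) (k1 k2 : nat) (p : 'M[R]_(2, 2)) :
    'M[R]_(2, 2) :=
  \matrix_(i, j) ((if j == 0 then k1%:R / inner (col 0 p) (col 0 p)
                   else k2%:R / inner (col 1 p) (col 1 p)) * p i j).

Section RowBlockSums.
Variables (R : realType) (m n1 n2 : nat) (I : finType).

Lemma row_mx_suml (F : I -> 'M[R]_(m, n1)) :
  row_mx (\sum_i F i) (0 : 'M[R]_(m, n2)) = \sum_i row_mx (F i) 0.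
Proof.
apply: (big_morph (fun A => row_mx A 0) _ (row_mx0 _ _ _ _)) => A B.
by rewrite add_row_mx addr0.
Qed.

Lemma row_mx_sumr (F : I -> 'M[R]_(m, n2)) :
  row_mx (0 : 'M[R]_(m, n1)) (\sum_i F i) = \sum_i row_mx 0 (F i).
Proof.
apply: (big_morph (row_mx 0) _ (row_mx0 _ _ _ _)) => A B.
by rewrite add_row_mx addr0.
Qed.

End RowBlockSums.

Section SpiralAlgebra.
Variables (R : realType) (k1 k2 m1 m2 : nat).
Variables (f1 : 'M[R]_(2, m1)) (X1 : 'I_k1 -> 'M[R]_(2, m1)).
Variables (f2 : 'M[R]_(2, m2)) (X2 : 'I_k2 -> 'M[R]_(2, m2)).
Variables (H1 : 'I_k1 -> 'I_k1 -> 'M[R]_(2, m1)).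
Variables (H2 : 'I_k2 -> 'I_k2 -> 'M[R]_(2, m2)).
Variables (z dz ddz : 'M[R]_(2, 2)).
Variable X : 'I_(1 + (k1 + k2)) -> 'M[R]_(2, m1 + m2).
Variable H : 'I_(1 + (k1 + k2)) -> 'I_(1 + (k1 + k2)) -> 'M[R]_(2, m1 + m2).
Let it : 'I_(1 + (k1 + k2)) := lshift (k1 + k2) 0.
Let ix a : 'I_(1 + (k1 + k2)) := rshift 1 (lshift k2 a).
Let iy b : 'I_(1 + (k1 + k2)) := rshift 1 (rshift k1 b).
Let n1 := inner (col 0 z) (col 0 z).
Let n2 := inner (col 1 z) (col 1 z).
Let nd := inner dz dz.
Hypothesis Xt : X it = row_mx (cscale (col 0 dz) f1) (cscale (col 1 dz) f2).
Hypothesis Xx : forall a, X (ix a) = row_mx (cscale (col 0 z) (X1 a)) 0.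
Hypothesis Xy : forall b, X (iy b) = row_mx 0 (cscale (col 1 z) (X2 b)).
Hypothesis Ht : H it it = row_mx (cscale (col 0 ddz) f1) (cscale (col 1 ddz) f2).
Hypothesis Hx : forall a b, H (ix a) (ix b) = row_mx (cscale (col 0 z) (H1 a b)) 0.
Hypothesis Hy : forall a b, H (iy a) (iy b) = row_mx 0 (cscale (col 1 z) (H2 a b)).
Hypothesis f1_unit : inner f1 f1 = 1.
Hypothesis f2_unit : inner f2 f2 = 1.
Hypothesis X1_tangent : forall i, inner f1 (X1 i) = 0.
Hypothesis X2_tangent : forall i, inner f2 (X2 i) = 0.
Hypothesis X1_real : forall i, inner (mulJ f1) (X1 i) = 0.
Hypothesis X2_real : forall i, inner (mulJ f2) (X2 i) = 0.

Lemma sum_spiral_index (V : nmodType) (F : 'I_(1 + (k1 + k2)) -> V) :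
  \sum_i F i = F it + (\sum_a F (ix a) + \sum_b F (iy b)).
Proof. by rewrite !big_split_ord big_ord1. Qed.

Lemma inner_cscale_orth m (f Y : 'M[R]_(2, m)) (w w' : 'cV[R]_2) :
  inner f Y = 0 -> inner (mulJ f) Y = 0 -> inner (cscale w f) (cscale w' Y) = 0.
Proof.
move=> fY JfY; rewrite /cscale !innerDl !innerDr !innerZl !innerZr inner_JJ.
have fJY : inner f (mulJ Y) = 0 by apply/eqP; rewrite -oppr_eq0 -inner_Jl JfY.
by rewrite fY JfY fJY !mulr0 !addr0.
Qed.

Lemma inner_cols (v w : 'M[R]_(2, 2)) :
  inner v w = inner (col 0 v) (col 0 w) + inner (col 1 v) (col 1 w).
Proof. by rewrite !innerE sum_ord2 !big_ord1 !mxE. Qed.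

(** The totally real conditions make the three families of coordinate
directions mutually orthogonal. *)
Lemma gram_spiral : gram X =
  block_mx nd%:M 0 0 (block_mx (n1 *: gram X1) 0 0 (n2 *: gram X2)).
Proof.
have tt : inner (X it) (X it) = nd.
  by rewrite Xt inner_row_mx !inner_cscale f1_unit f2_unit !mulr1 -inner_cols.
have tx a : inner (X it) (X (ix a)) = 0.
  by rewrite Xt Xx inner_row_mx inner0r addr0 inner_cscale_orth.
have ty b : inner (X it) (X (iy b)) = 0.
  by rewrite Xt Xy inner_row_mx inner0r add0r inner_cscale_orth.
have xy a b : inner (X (ix a)) (X (iy b)) = 0.
  by rewrite Xx Xy inner_row_mx inner0r inner0l addr0.
have xx a b : inner (X (ix a)) (X (ix b)) = n1 * inner (X1 a) (X1 b).
  by rewrite !Xx inner_row_mx inner0r addr0 inner_cscale.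
have yy a b : inner (X (iy a)) (X (iy b)) = n2 * inner (X2 a) (X2 b).
  by rewrite !Xy inner_row_mx inner0r add0r inner_cscale.
apply/matrixP => i j; rewrite [LHS]mxE.
case: (split_ordP i) => {}i ->; last (case: (split_ordP i) => {}i ->);
  (case: (split_ordP j) => {}j ->; last (case: (split_ordP j) => {}j ->)).
- by rewrite block_mxEul [i]ord1 [j]ord1 tt !mxE.
- by rewrite block_mxEur [i]ord1 tx mxE.
- by rewrite block_mxEur [i]ord1 ty mxE.
- by rewrite block_mxEdl [j]ord1 innerC tx mxE.
- by rewrite block_mxEdr block_mxEul xx !mxE.
- by rewrite block_mxEdr block_mxEur xy mxE.
- by rewrite block_mxEdl [j]ord1 innerC ty mxE.
- by rewrite block_mxEdr block_mxEdl innerC xy mxE.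
- by rewrite block_mxEdr block_mxEdr yy !mxE.
Qed.

Hypothesis X_gram_unit : gram X \in unitmx.

Lemma spiral_gram_unit : [/\ nd%:M \in unitmx (n := 1),
  n1 *: gram X1 \in unitmx & n2 *: gram X2 \in unitmx].
Proof.
move: X_gram_unit; rewrite gram_spiral !block_diag_mx_unit.
by case/and3P.
Qed.

(** The metric of a factor is scaled by [|z_i|^2], so nondegeneracy at a zero of
[z_i] forces the factor to be a point. *)
Lemma scaled_unit_dim k (c : R) (A : 'M[R]_k) : c *: A \in unitmx -> c = 0 -> k = 0%N.
Proof.
by case: k A => // k A + c0; rewrite c0 scale0r unitmxE det0 unitr0.
Qed.

Lemma inv_gram_spiral : invmx (gram X) =
  block_mx nd^-1%:M 0 0
    (block_mx (n1^-1 *: invmx (gram X1)) 0 0 (n2^-1 *: invmx (gram X2))).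
Proof.
have [ud u1 u2] := spiral_gram_unit.
rewrite gram_spiral invmx_block_diag; last by rewrite -gram_spiral.
by rewrite invmx_block_diag ?block_diag_mx_unit ?u1// invmx_scalar !invmxZ.
Qed.

(** The inverse metric is block diagonal, so the mixed second derivatives do not
contribute, and each block is divided by its own scale. *)
Lemma frame_trace_spiral : frame_trace X H = row_mx
  (cscale (nd^-1 *: col 0 ddz) f1 + cscale (n1^-1 *: col 0 z) (frame_trace X1 H1))
  (cscale (nd^-1 *: col 1 ddz) f2 + cscale (n2^-1 *: col 1 z) (frame_trace X2 H2)).
Proof.
rewrite /frame_trace inv_gram_spiral.
set G := block_mx nd^-1%:M _ _ _.
have G0 i j : G (lshift _ i) (rshift _ j) = 0 by rewrite /G block_mxEur mxE.
have G0' i j : G (rshift _ i) (lshift _ j) = 0 by rewrite /G block_mxEdl mxE.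
have Gt : G it it = nd^-1 by rewrite /G block_mxEul !mxE.
have Gx a b : G (ix a) (ix b) = n1^-1 * invmx (gram X1) a b.
  by rewrite /G block_mxEdr block_mxEul mxE.
have Gxy a b : G (ix a) (iy b) = 0.
  by rewrite /G block_mxEdr block_mxEur mxE.
have Gyx a b : G (iy a) (ix b) = 0.
  by rewrite /G block_mxEdr block_mxEdl mxE.
have Gy a b : G (iy a) (iy b) = n2^-1 * invmx (gram X2) a b.
  by rewrite /G block_mxEdr block_mxEdr mxE.
have rowx i : \sum_j G (ix i) j *: H (ix i) j =
    row_mx (cscale (n1^-1 *: col 0 z) (\sum_j invmx (gram X1) i j *: H1 i j)) 0.
  rewrite sum_spiral_index G0' scale0r add0r [X in _ + X]big1 ?addr0.
    rewrite cscale_sumr row_mx_suml; apply: eq_bigr => j _.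
    by rewrite Gx Hx scale_row_mx scaler0 cscaleZl cscaleZr scalerA.
  by move=> b _; rewrite Gxy scale0r.
have rowy i : \sum_j G (iy i) j *: H (iy i) j =
    row_mx 0 (cscale (n2^-1 *: col 1 z) (\sum_j invmx (gram X2) i j *: H2 i j)).
  rewrite sum_spiral_index G0' scale0r add0r big1 ?add0r.
    rewrite cscale_sumr row_mx_sumr; apply: eq_bigr => j _.
    by rewrite Gy Hy scale_row_mx scaler0 cscaleZl cscaleZr scalerA.
  by move=> b _; rewrite Gyx scale0r.
rewrite sum_spiral_index (eq_bigr _ (fun i _ => rowx i)) (eq_bigr _ (fun i _ => rowy i)).
rewrite -row_mx_suml -row_mx_sumr -!cscale_sumr.
rewrite sum_spiral_index Gt Ht [X in _ *: _ + (X + _)]big1; last first.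
  by move=> j _; rewrite G0 scale0r.
rewrite [X in _ *: _ + (_ + X)]big1; last by move=> j _; rewrite G0 scale0r.
by rewrite !addr0 scale_row_mx !add_row_mx addr0 add0r !cscaleZl.
Qed.

Let K := half_log_gradient k1 k2 z.

Lemma col_half_log_gradient : col 0 K = (k1%:R / n1) *: col 0 z /\
  col 1 K = (k2%:R / n2) *: col 1 z.
Proof. by split; apply/matrixP => i j; rewrite !mxE. Qed.

Lemma eq_cols (v w : 'M[R]_(2, 2)) :
  col 0 v = col 0 w -> col 1 v = col 1 w -> v = w.
Proof.
move=> /matrixP h0 /matrixP h1; apply/matrixP => i j.
by case: (ord2P j) => ->; [have := h0 i 0|have := h1 i 0]; rewrite !mxE.
Qed.

Hypothesis T1_radial : inner (frame_trace X1 H1) f1 = - k1%:R.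
Hypothesis T2_radial : inner (frame_trace X2 H2) f2 = - k2%:R.
Hypothesis T1_Jradial : inner (frame_trace X1 H1) (mulJ f1) = 0.
Hypothesis T2_Jradial : inner (frame_trace X2 H2) (mulJ f2) = 0.

Lemma frame_trace_dim0 k m (Y : 'I_k -> 'M[R]_(2, m)) HY :
  k = 0%N -> frame_trace Y HY = 0.
Proof. by case: k Y HY => // Y HY _; rewrite /frame_trace big_ord0. Qed.

(** The span condition decouples: Hermitian products with [f1] and [f2] leave a
condition on the curve alone, in which the two traces only enter through their
radial coefficients [- k1] and [- k2]. *)
Lemma spiral_span :
  frame_span (row_mx (cscale (col 0 z) f1) (cscale (col 1 z) f2)) X (frame_trace X H)
  <->
  [/\ frame_span f1 X1 (frame_trace X1 H1), frame_span f2 X2 (frame_trace X2 H2) &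
     exists a b : R, nd^-1 *: ddz - K = a *: z + b *: dz].
Proof.
have [_ u1 u2] := spiral_gram_unit; have [K0 K1] := col_half_log_gradient.
have z1k : col 0 z = 0 -> k1 = 0%N.
  by move=> z0; apply: scaled_unit_dim u1 _; rewrite /n1 z0 inner0l.
have z2k : col 1 z = 0 -> k2 = 0%N.
  by move=> z0; apply: scaled_unit_dim u2 _; rewrite /n2 z0 inner0l.
have spanE al c : al *: row_mx (cscale (col 0 z) f1) (cscale (col 1 z) f2)
    + \sum_i c i *: X i = row_mx
      (al *: cscale (col 0 z) f1 + c it *: cscale (col 0 dz) f1
        + \sum_a c (ix a) *: cscale (col 0 z) (X1 a))
      (al *: cscale (col 1 z) f2 + c it *: cscale (col 1 dz) f2
        + \sum_b c (iy b) *: cscale (col 1 z) (X2 b)).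
  rewrite sum_spiral_index Xt.
  have sumx : \sum_a c (ix a) *: X (ix a) =
      \sum_a row_mx (c (ix a) *: cscale (col 0 z) (X1 a)) 0.
    by apply: eq_bigr => a _; rewrite Xx scale_row_mx scaler0.
  have sumy : \sum_b c (iy b) *: X (iy b) =
      \sum_b row_mx 0 (c (iy b) *: cscale (col 1 z) (X2 b)).
    by apply: eq_bigr => b _; rewrite Xy scale_row_mx scaler0.
  rewrite sumx sumy.
  rewrite -row_mx_suml -row_mx_sumr !scale_row_mx !add_row_mx.
  by rewrite add0r addr0 !addrA.
split=> [[al [c]]|[S1 S2 [al [be E]]]].
  rewrite frame_trace_spiral spanE => /eq_row_mx [e1 e2].
  have [c1 s1] := spiral_factor_fwd f1_unit X1_tangent T1_radial X1_real
    T1_Jradial (@frame_trace_dim0 _ _ X1 H1) z1k e1.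
  have [c2 s2] := spiral_factor_fwd f2_unit X2_tangent T2_radial X2_real
    T2_Jradial (@frame_trace_dim0 _ _ X2 H2) z2k e2.
  split=> //; exists al, (c it); apply: eq_cols.
    by rewrite !linearD !linearN !linearZ /= K0.
  by rewrite !linearD !linearN !linearZ /= K1.
have [a1 [b1 T1E]] := S1; have [a2 [b2 T2E]] := S2.
have E0 : nd^-1 *: col 0 ddz - (k1%:R / n1) *: col 0 z = al *: col 0 z + be *: col 0 dz.
  rewrite -K0; apply/matrixP => i j; move/matrixP: E => /(_ i 0).
  by rewrite !mxE.
have E1 : nd^-1 *: col 1 ddz - (k2%:R / n2) *: col 1 z = al *: col 1 z + be *: col 1 dz.
  rewrite -K1; apply/matrixP => i j; move/matrixP: E => /(_ i 1).
  by rewrite !mxE.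
have [c1 e1] := spiral_factor_bwd f1_unit X1_tangent T1_radial T1E E0.
have [c2 e2] := spiral_factor_bwd f2_unit X2_tangent T2_radial T2E E1.
exists al, (fun i => match fintype.split i with inl _ => be
  | inr j => match fintype.split j with inl a => c1 a | inr b => c2 b end end).
rewrite frame_trace_spiral spanE e1 e2 /it /ix /iy (unsplitK (inl _)).
congr (row_mx (_ + _) (_ + _)); apply: eq_bigr => a _.
  by rewrite (unsplitK (inr _)) (unsplitK (inl _)).
by rewrite !(unsplitK (inr _)).
Qed.

End SpiralAlgebra.

(** * Mean curvature of a spiral product *)

Section SpiralCoordinates.
Variables (R : realType) (k1 k2 m1 m2 : nat).
Implicit Types (g : R -> 'M[R]_(2, 2)) (u v : 'rV[R]_(1 + (k1 + k2))).
Variables (I : set R) (O1 : set 'rV[R]_k1) (O2 : set 'rV[R]_k2).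

Definition time_part u : R := lsubmx u 0 0.
Definition first_part u : 'rV[R]_k1 := lsubmx (rsubmx u).
Definition second_part u : 'rV[R]_k2 := rsubmx (rsubmx u).

Lemma time_part_is_linear : linear time_part.
Proof. by move=> a u v; rewrite /time_part !mxE. Qed.
Lemma first_part_is_linear : linear first_part.
Proof. by move=> a u v; rewrite /first_part !linearP. Qed.
Lemma second_part_is_linear : linear second_part.
Proof. by move=> a u v; rewrite /second_part !linearP. Qed.

HB.instance Definition _ := GRing.isLinear.Build R 'rV[R]_(1 + (k1 + k2)) R _
  time_part time_part_is_linear.
HB.instance Definition _ := GRing.isLinear.Build R 'rV[R]_(1 + (k1 + k2)) 'rV[R]_k1 _
  first_part first_part_is_linear.
HB.instance Definition _ := GRing.isLinear.Build R 'rV[R]_(1 + (k1 + k2)) 'rV[R]_k2 _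
  second_part second_part_is_linear.

(** The coordinate expression of a spiral product.  The family is closed under
coordinate derivatives, each of which differentiates a single factor. *)
Definition spiral_coord g (F1 : 'rV[R]_k1 -> 'M[R]_(2, m1))
    (F2 : 'rV[R]_k2 -> 'M[R]_(2, m2)) u : 'M[R]_(2, m1 + m2) :=
  row_mx (cscale (col 0 (g (time_part u))) (F1 (first_part u)))
         (cscale (col 1 (g (time_part u))) (F2 (second_part u))).

Definition spiral_domain : set 'rV[R]_(1 + (k1 + k2)) :=
  [set u | [/\ I (time_part u), O1 (first_part u) & O2 (second_part u)]].

Let it : 'I_(1 + (k1 + k2)) := lshift (k1 + k2) 0.
Let ix a : 'I_(1 + (k1 + k2)) := rshift 1 (lshift k2 a).
Let iy b : 'I_(1 + (k1 + k2)) := rshift 1 (rshift k1 b).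

Lemma parts_delta_time : [/\ time_part (delta_mx 0 it) = 1,
  first_part (delta_mx 0 it) = 0 & second_part (delta_mx 0 it) = 0].
Proof.
split; first by rewrite /time_part !mxE !eqxx.
  by apply/matrixP=> i j; rewrite !mxE eq_rlshift andbF.
by apply/matrixP=> i j; rewrite !mxE eq_rlshift andbF.
Qed.

Lemma parts_delta_first a : [/\ time_part (delta_mx 0 (ix a)) = 0,
  first_part (delta_mx 0 (ix a)) = delta_mx 0 a &
  second_part (delta_mx 0 (ix a)) = 0].
Proof.
split; first by rewrite /time_part !mxE eq_lrshift andbF.
  by apply/matrixP=> i j; rewrite !mxE !(inj_eq (@rshift_inj _ _)) (inj_eq (@lshift_inj _ _)).
by apply/matrixP=> i j; rewrite !mxE !(inj_eq (@rshift_inj _ _)) eq_rlshift andbF.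
Qed.

Lemma parts_delta_second b : [/\ time_part (delta_mx 0 (iy b)) = 0,
  first_part (delta_mx 0 (iy b)) = 0 &
  second_part (delta_mx 0 (iy b)) = delta_mx 0 b].
Proof.
split; first by rewrite /time_part !mxE eq_lrshift andbF.
  by apply/matrixP=> i j; rewrite !mxE !(inj_eq (@rshift_inj _ _)) eq_lrshift andbF.
by apply/matrixP=> i j; rewrite !mxE !(inj_eq (@rshift_inj _ _)).
Qed.

(** Each factor depends linearly on the coordinates through one of the three
projections, so the product rule for complex scaling suffices. *)
Lemma is_derive_spiral g (F1 : 'rV[R]_k1 -> 'M[R]_(2, m1))
    (F2 : 'rV[R]_k2 -> 'M[R]_(2, m2)) u v :
  differentiable g (time_part u) -> differentiable F1 (first_part u) ->
  differentiable F2 (second_part u) ->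
  is_derive u v (spiral_coord g F1 F2) (row_mx
    (cscale (col 0 ('D_(time_part v) g (time_part u))) (F1 (first_part u))
     + cscale (col 0 (g (time_part u))) ('D_(first_part v) F1 (first_part u)))
    (cscale (col 1 ('D_(time_part v) g (time_part u))) (F2 (second_part u))
     + cscale (col 1 (g (time_part u))) ('D_(second_part v) F2 (second_part u)))).
Proof.
move=> dg dF1 dF2.
have hg : is_derive u v (fun y => g (time_part y)) ('D_(time_part v) g (time_part u)).
  by apply: (is_derive_comp_linear (L := time_part)); split => //; exact: diff_derivable.
have h1 : is_derive u v (fun y => F1 (first_part y)) ('D_(first_part v) F1 (first_part u)).
  by apply: (is_derive_comp_linear (L := first_part)); split => //; exact: diff_derivable.
have h2 : is_derive u v (fun y => F2 (second_part y)) ('D_(second_part v) F2 (second_part u)).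
  by apply: (is_derive_comp_linear (L := second_part)); split => //; exact: diff_derivable.
apply: is_derive_row_mx; apply: is_derive_cscale => //; exact: is_derive_col.
Qed.

Section Partials.
Variables (g : R -> 'M[R]_(2, 2)).
Variables (F1 : 'rV[R]_k1 -> 'M[R]_(2, m1)) (F2 : 'rV[R]_k2 -> 'M[R]_(2, m2)).
Hypothesis dg : forall t, I t -> differentiable g t.
Hypothesis dF1 : forall x, O1 x -> differentiable F1 x.
Hypothesis dF2 : forall x, O2 x -> differentiable F2 x.

Lemma partial_spiral_time u : spiral_domain u ->
  partial it (spiral_coord g F1 F2) u = spiral_coord ('D_1 g) F1 F2 u.
Proof.
move=> [/dg gu /dF1 F1u /dF2 F2u]; rewrite /partial.
rewrite (@derive_val _ _ _ _ _ _ _ (is_derive_spiral (delta_mx 0 it) gu F1u F2u)).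
by have [-> -> ->] := parts_delta_time; rewrite !derive0 !cscale0r !addr0.
Qed.

Lemma partial_spiral_first a u : spiral_domain u ->
  partial (ix a) (spiral_coord g F1 F2) u =
  spiral_coord g (partial a F1) (fun=> 0) u.
Proof.
move=> [/dg gu /dF1 F1u /dF2 F2u]; rewrite /partial.
rewrite (@derive_val _ _ _ _ _ _ _ (is_derive_spiral (delta_mx 0 (ix a)) gu F1u F2u)).
have [-> -> ->] := parts_delta_first a; rewrite !derive0 !linear0 !cscale0l.
by rewrite !add0r /spiral_coord !cscale0r.
Qed.

Lemma partial_spiral_second b u : spiral_domain u ->
  partial (iy b) (spiral_coord g F1 F2) u =
  spiral_coord g (fun=> 0) (partial b F2) u.
Proof.
move=> [/dg gu /dF1 F1u /dF2 F2u]; rewrite /partial.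
rewrite (@derive_val _ _ _ _ _ _ _ (is_derive_spiral (delta_mx 0 (iy b)) gu F1u F2u)).
have [-> -> ->] := parts_delta_second b; rewrite !derive0 !linear0 !cscale0l.
by rewrite !add0r /spiral_coord !cscale0r.
Qed.

End Partials.

Hypotheses (oI : open I) (oO1 : open O1) (oO2 : open O2).

Lemma open_spiral_domain : open spiral_domain.
Proof.
have -> : spiral_domain = time_part @^-1` I `&` (first_part @^-1` O1 `&` second_part @^-1` O2).
  by apply/seteqP; split=> u /=; [move=> []|move=> [? []]].
have ct : continuous time_part.
  move=> u; apply: (@continuous_comp _ _ _ (@lsubmx R 1 1 (k1 + k2))
    (fun M : 'M[R]_(1, 1) => M 0 0)).
    exact: continuous_lsubmx.
  exact: coord_continuous.
have cr : continuous (@rsubmx R 1 1 (k1 + k2)) by exact: continuous_rsubmx.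
have cx : continuous first_part.
  move=> u; apply: (@continuous_comp _ _ _ (@rsubmx R 1 1 (k1 + k2)) lsubmx).
    exact: cr.
  exact: continuous_lsubmx.
have cy : continuous second_part.
  move=> u; apply: (@continuous_comp _ _ _ (@rsubmx R 1 1 (k1 + k2)) rsubmx).
    exact: cr.
  exact: continuous_rsubmx.
by apply: openI; [|apply: openI]; apply: open_comp; [move=> u _; exact: ct|exact: oI|
  move=> u _; exact: cx|exact: oO1|move=> u _; exact: cy|exact: oO2].
Qed.

End SpiralCoordinates.

(** The part of the geodesic equation of the weighted metric that does not
depend on the parametrization: the acceleration, corrected by the gradient of
the weight, has no component normal to both position and velocity. *)
Definition weighted_geodesic_curvature_free (R : realType) (k1 k2 : nat)
    (g : R -> 'M[R]_(2, 2)) (t : R) : Prop :=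
  exists a b : R,
    (inner ('D_1 g t) ('D_1 g t))^-1 *: 'D_1 ('D_1 g) t
      - half_log_gradient k1 k2 (g t) = a *: g t + b *: 'D_1 g t.

Section SpiralMeanCurvature.
Variables (R : realType) (k1 k2 m1 m2 : nat).
Variables (g : R -> 'M[R]_(2, 2)).
Variables (F1 : 'rV[R]_k1 -> 'M[R]_(2, m1)) (F2 : 'rV[R]_k2 -> 'M[R]_(2, m2)).
Variables (I : set R) (O1 : set 'rV[R]_k1) (O2 : set 'rV[R]_k2).
Hypotheses (oI : open I) (oO1 : open O1) (oO2 : open O2).
Hypotheses (sg : smooth_on I g) (sF1 : smooth_on O1 F1) (sF2 : smooth_on O2 F2).
Hypothesis g_sphere : forall t, I t -> inner (g t) (g t) = 1.
Hypothesis F1_sphere : forall x, O1 x -> inner (F1 x) (F1 x) = 1.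
Hypothesis F2_sphere : forall x, O2 x -> inner (F2 x) (F2 x) = 1.
Hypothesis F1_real : forall x v, O1 x -> inner (mulJ (F1 x)) ('D_v F1 x) = 0.
Hypothesis F2_real : forall x v, O2 x -> inner (mulJ (F2 x)) ('D_v F2 x) = 0.
Hypothesis F1_imm : forall x v, O1 x -> 'D_v F1 x = 0 -> v = 0.
Hypothesis F2_imm : forall x v, O2 x -> 'D_v F2 x = 0 -> v = 0.
Let D := @spiral_domain R k1 k2 I O1 O2.
Let G := spiral_coord g F1 F2.
Hypothesis sG : smooth_on D G.
Hypothesis G_imm : forall u v, D u -> 'D_v G u = 0 -> v = 0.

Lemma spiral_coord_sphere u : D u -> inner (G u) (G u) = 1.
Proof.
case=> /g_sphere It /F1_sphere Ox /F2_sphere Oy.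
by rewrite /G /spiral_coord inner_row_mx !inner_cscale Ox Oy !mulr1 -inner_cols.
Qed.

Lemma partial2_spiral i j (S : 'rV[R]_(1 + (k1 + k2)) -> 'M[R]_(2, m1 + m2)) u :
  D u -> (forall y, D y -> partial j G y = S y) ->
  partial i (partial j G) u = partial i S u.
Proof.
by move=> Du GS; rewrite /partial; apply: derive_eq_on Du GS; exact: open_spiral_domain.
Qed.

(** The local form of the theorem: at a point, minimality splits into minimality of
the two factors and a second order condition on the curve. *)
Lemma spiral_mean_curvature_eq0P u : D u ->
  mean_curvature G u = 0 <->
  [/\ mean_curvature F1 (first_part u) = 0,
      mean_curvature F2 (second_part u) = 0 &
      weighted_geodesic_curvature_free k1 k2 g (time_part u)].
Proof.
move=> Du; have [It Ox Oy] := Du.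
have oD : open D by exact: open_spiral_domain.
have dg t : I t -> differentiable g t by exact: smooth_on_diff sg.
have dg' t : I t -> differentiable ('D_1 g) t.
  exact: smooth_on_diff (smooth_on_derive (1 : R) sg).
have dF1 x : O1 x -> differentiable F1 x by exact: smooth_on_diff sF1.
have dF2 x : O2 x -> differentiable F2 x by exact: smooth_on_diff sF2.
have dF1' a x : O1 x -> differentiable (partial a F1) x.
  exact: smooth_on_diff (smooth_on_derive (delta_mx 0 a) sF1).
have dF2' a x : O2 x -> differentiable (partial a F2) x.
  exact: smooth_on_diff (smooth_on_derive (delta_mx 0 a) sF2).
have d0 m k (O : set 'rV[R]_k) x : O x -> differentiable (fun=> 0 : 'M[R]_(2, m)) x.
  by move=> _; exact: differentiable_cst.
have gram1 : gram (coord_frame F1 (first_part u)) \in unitmx.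
  by apply: first_form_unit => [|v]; [exact: dF1|exact: F1_imm].
have gram2 : gram (coord_frame F2 (second_part u)) \in unitmx.
  by apply: first_form_unit => [|v]; [exact: dF2|exact: F2_imm].
have gramG : gram (coord_frame G u) \in unitmx.
  by apply: first_form_unit => [|v]; [exact: smooth_on_diff sG Du|exact: G_imm].
have tan1 a : inner (F1 (first_part u)) (coord_frame F1 (first_part u) a) = 0.
  exact: (sphere_orth_derive oO1 sF1 F1_sphere).
have tan2 a : inner (F2 (second_part u)) (coord_frame F2 (second_part u) a) = 0.
  exact: (sphere_orth_derive oO2 sF2 F2_sphere).
have tanG a : inner (G u) (coord_frame G u a) = 0.
  exact: (sphere_orth_derive oD sG spiral_coord_sphere).
have p1 := F1_sphere Ox; have p2 := F2_sphere Oy.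
have e1 := mean_curvature_eq0P p1 tan1 gram1.
have e2 := mean_curvature_eq0P p2 tan2 gram2.
have eG := mean_curvature_eq0P (spiral_coord_sphere Du) tanG gramG.
have [T1r T1J] := cinner_hessian_trace oO1 sF1 F1_sphere F1_real Ox gram1.
have [T2r T2J] := cinner_hessian_trace oO2 sF2 F2_sphere F2_real Oy gram2.
have Gt y : D y -> partial (lshift _ 0) G y = spiral_coord ('D_1 g) F1 F2 y.
  exact: partial_spiral_time.
have Gx a y : D y -> partial (rshift 1 (lshift k2 a)) G y =
    spiral_coord g (partial a F1) (fun=> 0) y.
  exact: partial_spiral_first.
have Gy b y : D y -> partial (rshift 1 (rshift k1 b)) G y =
    spiral_coord g (fun=> 0) (partial b F2) y.
  exact: partial_spiral_second.
have span : frame_span (G u) (coord_frame G u) (hessian_trace G u) <->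
    [/\ frame_span (F1 (first_part u)) (coord_frame F1 (first_part u))
           (hessian_trace F1 (first_part u)),
        frame_span (F2 (second_part u)) (coord_frame F2 (second_part u))
           (hessian_trace F2 (second_part u)) &
        weighted_geodesic_curvature_free k1 k2 g (time_part u)].
  apply: spiral_span => //.
  - exact: Gt.
  - by move=> a; rewrite [LHS]Gx// /spiral_coord cscale0r.
  - by move=> b; rewrite [LHS]Gy// /spiral_coord cscale0r.
  - by rewrite [LHS](partial2_spiral _ Du Gt) (partial_spiral_time dg' dF1 dF2).
  - move=> a b; rewrite [LHS](partial2_spiral _ Du (Gx b)).
    rewrite (partial_spiral_first dg (dF1' b) (d0 _ _ O2))//.
    by rewrite /spiral_coord cscale0r.
  - move=> a b; rewrite [LHS](partial2_spiral _ Du (Gy b)).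
    rewrite (partial_spiral_second dg (d0 _ _ O1) (dF2' b))//.
    by rewrite /spiral_coord cscale0r.
  - by move=> a; exact: F1_real.
  - by move=> b; exact: F2_real.
split=> [/eG /span [/e1 ? /e2 ? ?] //|[/e1 ? /e2 ? ?]].
by apply/eG/span; split.
Qed.

(** At a zero of [z_i] the directions of the [i]-th factor are in the kernel of the
differential, so an immersion has none there. *)
Lemma spiral_nondegenerate u : D u ->
  ((0 < k1)%N -> col 0 (g (time_part u)) != 0) /\
  ((0 < k2)%N -> col 1 (g (time_part u)) != 0).
Proof.
move=> Du; have [It Ox Oy] := Du.
have dg t : I t -> differentiable g t by exact: smooth_on_diff sg.
have dF1 x : O1 x -> differentiable F1 x by exact: smooth_on_diff sF1.
have dF2 x : O2 x -> differentiable F2 x by exact: smooth_on_diff sF2.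
split=> k_gt0; apply/eqP => z0.
  have := G_imm Du (etrans (partial_spiral_first dg dF1 dF2 (Ordinal k_gt0) Du) _).
  rewrite /spiral_coord z0 cscale0l cscale0r row_mx0 => /(_ erefl).
  move/matrixP/(_ 0 (rshift 1 (lshift k2 (Ordinal k_gt0)))).
  by rewrite !mxE !eqxx => /eqP; rewrite oner_eq0.
have := G_imm Du (etrans (partial_spiral_second dg dF1 dF2 (Ordinal k_gt0) Du) _).
rewrite /spiral_coord z0 cscale0l cscale0r row_mx0 => /(_ erefl).
move/matrixP/(_ 0 (rshift 1 (rshift k1 (Ordinal k_gt0)))).
by rewrite !mxE !eqxx => /eqP; rewrite oner_eq0.
Qed.

End SpiralMeanCurvature.

(** * Closure properties of smooth maps *)

Lemma Cn_on_subset (R : realType) (V W : normedModType R) (U U' : set V) n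
    (f : V -> W) :
  U' `<=` U -> Cn_on n U f -> Cn_on n U' f.
Proof.
move=> UU; elim: n f => [|n IHn] f.
  by move=> cf x /UU; exact: cf.
by move=> [df Df]; split=> [x /UU|v]; [exact: df|apply: IHn; exact: Df].
Qed.

Lemma Cn_on_id (R : realType) (V : normedModType R) (U : set V) n : Cn_on n U id.
Proof.
case: n => [|n] /=; first by move=> x _; exact: cvg_id.
split=> [x _|v]; first by have [] := is_diff_id x.
have -> : 'D_v id = (fun=> v) :> (V -> V) by apply/funext => x; rewrite derive_id.
exact: smooth_on_cst.
Qed.

Section CnCalculus.
Variables (R : realType) (V : normedModType R) (U : set V).
Hypothesis oU : open U.

(** The little-o expansion of [f] is one for [g], because the two agree near [x];
uniqueness then identifies the differential. *)
Lemma differentiable_eq_on (W : normedModType R) (f g : V -> W) x :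
  U x -> (forall y, U y -> f y = g y) -> differentiable f x -> differentiable g x.
Proof.
move=> Ux fg df; have fgx : \forall h \near (0 : V), f (h + x) = g (h + x).
  have : \forall y \near x, f y = g y.
    by near=> y; apply: fg; near: y; exact: open_nbhs_nbhs.
  by rewrite (near_shift 0 x) subr0.
have gE : g \o shift x = cst (g x) + 'd f x +o_ 0 id.
  apply/eqaddoP => e e0.
  have := diff_locally df => /eqaddoP /(_ e e0).
  apply: filter_app; near=> h; rewrite /= /cst !fctE /= -(fg x Ux).
  by have -> // : f (h + x) = g (h + x) by near: h.
apply/diff_locallyP.
rewrite (diff_unique (diff_continuous df) gE); split=> //.
exact: diff_continuous.
Unshelve. all: by end_near. Qed.

(** Derivative formulas only hold on [U]; this makes them usable in the induction on
the order that proves the closure properties below. *)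
Lemma Cn_on_eq (W : normedModType R) n (f g : V -> W) :
  (forall y, U y -> f y = g y) -> Cn_on n U f -> Cn_on n U g.
Proof.
elim: n f g => [|n IHn] f g fg /=.
  move=> cf x Ux; have := cf x Ux.
  rewrite /prop_for /continuous_at (fg x Ux); apply: cvg_trans.
  by apply: near_eq_cvg; near=> y; apply: fg; near: y; exact: open_nbhs_nbhs.
move=> [df Df]; split=> [x Ux|v].
  by apply: differentiable_eq_on fg _ => //; exact: df.
by apply: IHn (Df v) => y Uy; exact: derive_eq_on fg.
Unshelve. all: by end_near. Qed.

Lemma Cn_onW (W : normedModType R) n (f : V -> W) : Cn_on n.+1 U f -> Cn_on n U f.
Proof.
elim: n f => [|n IHn] f [df Df].
  by move=> x Ux; apply: differentiable_continuous; exact: df.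
by split=> // v; apply: IHn; exact: Df.
Qed.

Lemma Cn_on_is_derive (W : normedModType R) n (f : V -> W) x v :
  Cn_on n.+1 U f -> U x -> is_derive x v f ('D_v f x).
Proof. by move=> [df _] Ux; split=> //; apply: diff_derivable; exact: df. Qed.

Lemma Cn_onD (W : normedModType R) n (f g : V -> W) :
  Cn_on n U f -> Cn_on n U g -> Cn_on n U (fun x => f x + g x).
Proof.
elim: n f g => [|n IHn] f g hf hg.
  by move=> x Ux; apply: continuousD; [exact: hf|exact: hg].
have [[df Df] [dg Dg]] := (hf, hg); split=> [x Ux|v].
  by apply: differentiableD; [exact: df|exact: dg].
apply: Cn_on_eq (IHn _ _ (Df v) (Dg v)) => x Ux.
by have [_ ->] := is_derive_plus (Cn_on_is_derive v hf Ux) (Cn_on_is_derive v hg Ux).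
Qed.

Lemma Cn_onM n (f g : V -> R) :
  Cn_on n U f -> Cn_on n U g -> Cn_on n U (fun x => f x * g x).
Proof.
elim: n f g => [|n IHn] f g hf hg.
  by move=> x Ux; apply: continuousM; [exact: hf|exact: hg].
have [[df Df] [dg Dg]] := (hf, hg); split=> [x Ux|v].
  by apply: differentiableM; [exact: df|exact: dg].
apply: Cn_on_eq (Cn_onD (IHn _ _ (Df v) (Cn_onW hg)) (IHn _ _ (Cn_onW hf) (Dg v))).
move=> x Ux.
by have [_ ->] := is_derive_prod (Cn_on_is_derive v hf Ux) (Cn_on_is_derive v hg Ux).
Qed.

(** The derivative of the inverse is a product involving the inverse itself, so
each order of smoothness yields the next. *)
Lemma Cn_onV n (f : V -> R) :
  (forall x, U x -> f x != 0) -> Cn_on n U f -> Cn_on n U (fun x => (f x)^-1).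
Proof.
move=> f0; elim: n => [|n IHn] hf.
  by move=> x Ux; apply: continuousV; [exact: f0|exact: hf].
have [df Df] := hf; split=> [x Ux|v].
  by apply: differentiableV; [exact: df|exact: f0].
have fV := IHn (Cn_onW hf).
have fV2 := Cn_onM (smooth_on_cst U (-1 : R) n) (Cn_onM fV fV).
apply: Cn_on_eq (Cn_onM fV2 (Df v)) => x Ux.
have [hd _] := Cn_on_is_derive v hf Ux.
rewrite (@deriveV _ _ f)//; last exact: f0.
by rewrite /GRing.scale /= mulN1r -invfM -expr2.
Qed.

Lemma Cn_on_sum n (m : nat) (W : normedModType R) (f : 'I_m -> V -> W) :
  (forall i, Cn_on n U (f i)) -> Cn_on n U (fun x => \sum_(i < m) f i x).
Proof.
elim: m f => [|m IHm] f hf.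
  apply: Cn_on_eq (smooth_on_cst U (0 : W) n) => x _.
  by rewrite big_ord0.
apply: Cn_on_eq (Cn_onD (hf ord0) (IHm _ (fun i => hf (lift ord0 i)))) => x _.
by rewrite big_ord_recl.
Qed.

(** The chain rule along a real-valued inner function, for which the
directional derivatives of the outer one reduce to a single one. *)
Lemma Cn_on_comp_real (W : normedModType R) n (I : set R) (w : R -> W) (t : V -> R) :
  (forall n (a : V -> R) (f : V -> W), Cn_on n U a -> Cn_on n U f ->
     Cn_on n U (fun x => a x *: f x)) ->
  (forall x, U x -> I (t x)) ->
  Cn_on n I w -> Cn_on n U t -> Cn_on n U (fun x => w (t x)).
Proof.
move=> scl tI; elim: n w => [|n IHn] w hw ht.
  move=> x Ux; apply: continuous_comp; first exact: ht.
  by apply: hw; exact: tI.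
have [[dw Dw] [dt Dt]] := (hw, ht).
have dwt x : U x -> differentiable (w \o t) x.
  by move=> Ux; apply: differentiable_comp; [exact: dt|apply: dw; exact: tI].
split=> [x Ux|v]; first exact: dwt.
apply: Cn_on_eq (scl _ _ _ (Dt v) (IHn _ (Dw 1) (Cn_onW ht))) => x Ux.
have dwx := dw _ (tI _ Ux).
have [_ ->] := is_derive_comp v (dt x Ux) dwx.
exact/esym/derive_real_dir.
Qed.

Lemma Cn_on_mxP m p n (F : V -> 'M[R]_(m, p)) :
  Cn_on n U F <-> forall i j, Cn_on n U (fun x => F x i j).
Proof.
split.
  elim: n F => [|n IHn] F hF i j.
    move=> x Ux; apply: (@continuous_comp _ _ _ F (fun M : 'M[R]_(m, p) => M i j)).
      exact: hF.
    exact: coord_continuous.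
  have [dF DF] := hF; split=> [x Ux|v].
    apply: (@differentiable_comp _ _ _ _ F (fun M : 'M[R]_(m, p) => M i j)).
      exact: dF.
    exact: differentiable_coord.
  apply: Cn_on_eq (IHn _ (DF v) i j) => x Ux.
  by have /is_derive_mxP /(_ i j) [_ ->] := Cn_on_is_derive v hF Ux.
suff scl n' (f : V -> R) i j : Cn_on n' U f ->
    Cn_on n' U (fun x => f x *: (delta_mx i j : 'M[R]_(m, p))).
  move=> hF; apply: Cn_on_eq (Cn_on_sum (fun i => Cn_on_sum (fun j => scl n _ i j (hF i j)))).
  by move=> x _; rewrite -matrix_sum_delta.
elim: n' f => [|n' IHn] f hf.
  by move=> x Ux; apply: continuousZl; exact: hf.
have [df Df] := hf; split=> [x Ux|v]; first by apply: differentiableZl; exact: df.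
apply: Cn_on_eq (IHn _ (Df v)) => x Ux.
have [_ ->] := is_derive_scalef (Cn_on_is_derive v hf Ux)
  (is_derive_cst (delta_mx i j : 'M[R]_(m, p)) x v).
by rewrite scaler0 addr0.
Qed.

Lemma Cn_onZ m p n (a : V -> R) (F : V -> 'M[R]_(m, p)) :
  Cn_on n U a -> Cn_on n U F -> Cn_on n U (fun x => a x *: F x).
Proof.
move=> ha /Cn_on_mxP hF; apply/Cn_on_mxP => i j.
by apply: Cn_on_eq (Cn_onM ha (hF i j)) => x _; rewrite mxE.
Qed.

Lemma Cn_on_comp_mx m p n (I : set R) (w : R -> 'M[R]_(m, p)) (t : V -> R) :
  (forall x, U x -> I (t x)) ->
  Cn_on n I w -> Cn_on n U t -> Cn_on n U (fun x => w (t x)).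
Proof. by apply: Cn_on_comp_real => *; exact: Cn_onZ. Qed.

Lemma Cn_on_comp n (I : set R) (w : R -> R) (t : V -> R) :
  (forall x, U x -> I (t x)) ->
  Cn_on n I w -> Cn_on n U t -> Cn_on n U (fun x => w (t x)).
Proof. by apply: Cn_on_comp_real => *; exact: Cn_onM. Qed.

Lemma Cn_on_inner m n (F G : V -> 'M[R]_(2, m)) :
  Cn_on n U F -> Cn_on n U G -> Cn_on n U (fun x => inner (F x) (G x)).
Proof.
move=> /Cn_on_mxP hF /Cn_on_mxP hG; apply: Cn_on_sum => i; apply: Cn_on_sum => j.
exact: Cn_onM.
Qed.

Lemma Cn_on_col m p n (F : V -> 'M[R]_(m, p)) j :
  Cn_on n U F -> Cn_on n U (fun x => col j (F x)).
Proof.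
move=> /Cn_on_mxP hF; apply/Cn_on_mxP => i k.
by apply: Cn_on_eq (hF i j) => x _; rewrite mxE.
Qed.

Lemma Cn_onX n (f : V -> R) k : Cn_on n U f -> Cn_on n U (fun x => f x ^+ k).
Proof.
move=> hf; elim: k => [|k IHk]; first exact: smooth_on_cst.
by apply: Cn_on_eq (Cn_onM hf IHk) => x _; rewrite exprS.
Qed.

(** As for inverses, the derivative is expressed through the function. *)
Lemma Cn_on_sqrt n (f : V -> R) : (forall x, U x -> 0 < f x) ->
  Cn_on n U f -> Cn_on n U (fun x => Num.sqrt (f x)).
Proof.
move=> f_gt0; elim: n => [|n IHn] hf.
  by move=> x Ux; apply: continuous_comp; [exact: hf|exact: sqrt_continuous].
have [df Df] := hf.
have ds x : U x -> differentiable (Num.sqrt : R -> R) (f x).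
  move=> Ux; apply/derivable1_diffP.
  by have [] := is_derive1_sqrt (f_gt0 x Ux).
split=> [x Ux|v].
  by apply: (@differentiable_comp _ _ _ _ f); [exact: df|exact: ds].
have s_neq0 x : U x -> 2 * Num.sqrt (f x) != 0.
  by move=> Ux; rewrite mulf_neq0 ?pnatr_eq0// gt_eqF// sqrtr_gt0 f_gt0.
have hs := Cn_onV s_neq0 (Cn_onM (smooth_on_cst U (2 : R) n) (IHn (Cn_onW hf))).
apply: Cn_on_eq (Cn_onM (Df v) hs) => x Ux.
have [_ ->] := is_derive_comp v (df x Ux) (ds x Ux).
rewrite (derive_real_dir _ (ds x Ux)).
by have [_ ->] := is_derive1_sqrt (f_gt0 x Ux).
Qed.

End CnCalculus.

(** * Symmetry of second derivatives *)

Lemma ltr_dist_triangle (R : realDomainType) (p q r e f : R) :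
  `|p - r| < e -> `|q - r| < f -> `|p - q| < e + f.
Proof.
move=> pr; rewrite distrC -(subrKA r p) => qr.
by apply: le_lt_trans (ler_normD _ _) _; rewrite ltrD.
Qed.

Section MixedDerivatives.
Variables (R : realType) (V : normedModType R).

Lemma is_derive_line (W : normedModType R) (f : V -> W) (y a : V) r :
  derivable f (y + r *: a) a ->
  is_derive r (1 : R) (fun s => f (y + s *: a)) ('D_a f (y + r *: a)).
Proof.
move=> df; have qE : (fun h : R => h^-1 *:
      (((fun s => f (y + s *: a)) \o shift r) (h *: (1 : R)) - f (y + r *: a)))
    = (fun h => h^-1 *: ((f \o shift (y + r *: a)) (h *: a) - f (y + r *: a))).
  apply/funext => h /=; congr (_ *: (f _ - _)).
  by rewrite [h *: 1]mulr1 scalerDl addrCA.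
by split; rewrite /derivable /derive qE.
Qed.

Lemma MVT_closed (f df : R -> R) (d : R) : 0 < d ->
  (forall r, 0 <= r <= d -> is_derive r (1 : R) f (df r)) ->
  exists2 c, 0 <= c <= d & f d - f 0 = d * df c.
Proof.
move=> d0 hd; have [|r|c cd E] := @MVT _ f df 0 d d0.
- by move=> r /[!in_itv]/= /andP[r0 rd]; apply: hd; rewrite !ltW.
- apply: continuous_in_subspaceT => s /[!inE]/= /[!in_itv]/= sd.
  by apply/differentiable_continuous/derivable1_diffP; case: (hd s sd).
exists c; first by move: cd; rewrite in_itv /= => /andP[c0 cd]; rewrite !ltW.
by move: E; rewrite subr0 mulrC.
Qed.

Variables (U : set V) (f : V -> R).
Hypotheses (oU : open U) (sf : smooth_on U f).

(** The second difference of [f] over a small parallelogram, read through the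
mean value theorem in each direction. *)
Lemma second_difference_MVT (x a b : V) (d : R) : 0 < d ->
  (forall r s, 0 <= r <= d -> 0 <= s <= d -> U (x + r *: a + s *: b)) ->
  exists c e : R, [/\ 0 <= c <= d, 0 <= e <= d &
    f (x + d *: a + d *: b) - f (x + d *: a) - (f (x + d *: b) - f x)
      = d * (d * 'D_b ('D_a f) (x + c *: a + e *: b))].
Proof.
move=> d0 hU.
have dd : 0 <= d <= d by rewrite lexx ltW.
have z0 : 0 <= (0 : R) <= d by rewrite lexx ltW.
have Uxa r : 0 <= r <= d -> U (x + r *: a).
  by move=> rd; have := hU r 0 rd z0; rewrite scale0r addr0.
have [|c cd E1] := @MVT_closed (fun r => f (x + d *: b + r *: a) - f (x + r *: a))
    (fun r => 'D_a f (x + d *: b + r *: a) - 'D_a f (x + r *: a)) d d0.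
  move=> r rd; apply: is_deriveB; apply: is_derive_line; apply: diff_derivable.
    by apply: smooth_on_diff sf _; rewrite addrAC; exact: hU.
  by apply: smooth_on_diff sf _; exact: Uxa.
have [|e ed E2] := @MVT_closed (fun s => 'D_a f (x + c *: a + s *: b))
    (fun s => 'D_b ('D_a f) (x + c *: a + s *: b)) d d0.
  move=> s sd; apply: is_derive_line; apply: diff_derivable.
  by apply: smooth_on_diff (smooth_on_derive a sf) _; exact: hU.
exists c, e; split=> //; rewrite -E2 scale0r addr0.
have := E1; rewrite !scale0r !addr0 [x + d *: b + c *: a]addrAC => <-.
by rewrite [x + d *: b + d *: a]addrAC.
Qed.

(** Both mixed derivatives are limits of the same second difference over small
parallelograms; continuity at [x] identifies them. *)
Lemma derive_comm (x a b : V) : U x -> 'D_a ('D_b f) x = 'D_b ('D_a f) x.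
Proof.
move=> Ux; apply/eqP; rewrite -subr_eq0 -normr_eq0 -[_ == 0]negbK; apply/negP => n0.
set P := 'D_a ('D_b f); set Q := 'D_b ('D_a f).
pose eps := `|P x - Q x| / 2.
have eps0 : 0 < eps by rewrite divr_gt0// normr_gt0 -normr_eq0.
have cP : {for x, continuous P}.
  apply: differentiable_continuous.
  exact: smooth_on_diff (smooth_on_derive a (smooth_on_derive b sf)) Ux.
have cQ : {for x, continuous Q}.
  apply: differentiable_continuous.
  exact: smooth_on_diff (smooth_on_derive b (smooth_on_derive a sf)) Ux.
have hP0 : \forall y \near x, `|P x - P y| < eps.
  exact: (@cvgr_dist_lt _ _ _ _ _ P (P x) cP).
have hQ0 : \forall y \near x, `|Q x - Q y| < eps.
  exact: (@cvgr_dist_lt _ _ _ _ _ Q (Q x) cQ).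
have hU0 : \forall y \near x, U y by exact: open_nbhs_nbhs.
have /nbhs_ballP [rho /= rho0] : nbhs x (U `&`
    ([set y | `|P x - P y| < eps] `&` [set y | `|Q x - Q y| < eps])).
  by apply: filterI; [exact: hU0|apply: filterI; [exact: hP0|exact: hQ0]].
rewrite -ball_normE => near_x.
(* With this side every point of the parallelogram is within [rho] of [x]; the
   summand 1 covers [a = b = 0]. *)
pose d := rho / (`|a| + `|b| + 1).
have ab0 : 0 < `|a| + `|b| + 1 by rewrite ltr_wpDl// addr_ge0.
have d0 : 0 < d by rewrite divr_gt0.
have in_ball a' b' r s : `|a'| + `|b'| + 1 = `|a| + `|b| + 1 -> 0 <= r <= d ->
    0 <= s <= d -> `|x - (x + r *: a' + s *: b')| < rho.
  move=> ab' /andP[r0 rd] /andP[s0 sd].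
  rewrite -addrA opprD addNKr -normrN opprK.
  apply: le_lt_trans (ler_normD _ _) _; rewrite !normrZ !ger0_norm//.
  have dab : d * (`|a'| + `|b'| + 1) = rho by rewrite ab' mulfVK// gt_eqF.
  have h1 : r * `|a'| <= d * `|a'| by rewrite ler_wpM2r.
  have h2 : s * `|b'| <= d * `|b'| by rewrite ler_wpM2r.
  lra.
have [|c [e [cd ed E1]]] := second_difference_MVT (x := x) (a := a) (b := b) d0.
  by move=> r s rd sd; have [] /= := near_x _ (in_ball a b r s erefl rd sd).
have ba : `|b| + `|a| + 1 = `|a| + `|b| + 1 by rewrite [`|b| + _]addrC.
have [|c' [e' [cd' ed' E2]]] := second_difference_MVT (x := x) (a := b) (b := a) d0.
  by move=> r s rd sd; have [] := near_x _ (in_ball b a r s ba rd sd).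
have [_ [_ hQ]] := near_x _ (in_ball a b c e erefl cd ed).
have [_ [hP _]] := near_x _ (in_ball b a c' e' ba cd' ed').
have PQ : P (x + c' *: b + e' *: a) = Q (x + c *: a + e *: b).
  have dn0 : d != 0 by rewrite gt_eqF.
  apply: (mulfI dn0); apply: (mulfI dn0).
  apply: (etrans (esym E2)); apply: etrans E1; rewrite (addrAC x (d *: b)).
  move: (f (x + d *: a + d *: b)) (f (x + d *: a)) (f (x + d *: b)) (f x).
  by move=> A B C D; ring.
have := ltr_dist_triangle (eq_ind _ (fun p => `|P x - p| < eps) hP _ PQ) hQ.
by rewrite /eps -splitr ltxx.
Qed.

End MixedDerivatives.

(** * Geodesics of a weighted metric on the three-sphere *)

Section ChristoffelAlgebra.
Variables (R : realType) (k m : nat).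
Variables (X : 'I_k -> 'M[R]_(2, m)) (H : 'I_k -> 'I_k -> 'M[R]_(2, m)).
Variables (K : 'M[R]_(2, m)) (L : R) (dc ddc : 'I_k -> R).
Hypothesis H_sym : forall a b, H a b = H b a.
Hypothesis L_neq0 : L != 0.
Hypothesis gram_unitX : gram X \in unitmx.

(** The derivative in the direction [d] of the coefficient [(a, b)] of the metric
[L * gram X] when the differential of [L] is [2 * L * inner K _]. *)
Definition conformal_metric_derive (d a b : 'I_k) : R :=
  2 * L * inner K (X d) * inner (X a) (X b)
  + L * (inner (H d a) (X b) + inner (X a) (H d b)).

Let dh := conformal_metric_derive.
Let vel := \sum_a dc a *: X a.
Let acc := \sum_a (ddc a *: X a + dc a *: \sum_b dc b *: H b a).

Lemma quadratic_sum (f : 'I_k -> R) (g : 'I_k -> R) :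
  (\sum_a f a) * (\sum_b g b) = \sum_a \sum_b f a * g b.
Proof. by rewrite mulr_suml; apply: eq_bigr => a _; rewrite mulr_sumr. Qed.

Lemma double_sum_sym (f : 'I_k -> 'I_k -> R) :
  2 * (\sum_a \sum_b f a b) = \sum_a \sum_b (f a b + f b a).
Proof.
rewrite mulr_natl mulr2n [X in _ + X]exchange_big -big_split.
by apply: eq_bigr => a _; rewrite -big_split.
Qed.

(** Lowering the index of the geodesic equation of a conformal metric [L g]
turns it into orthogonality to the coordinate frame of an ambient vector.  The
symmetry of the Hessian cancels the derivatives of [g] that are not contracted
twice with the velocity. *)
Lemma lowered_geodesic_term d :
  \sum_l L * inner (X d) (X l) * ddc l
  + \sum_a \sum_b 2^-1 * (dh a b d + dh b a d - dh d a b) * dc a * dc b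
  = L * inner (acc + (2 * inner K vel) *: vel - inner vel vel *: K) (X d).
Proof.
have Ev w : inner vel w = \sum_a dc a * inner (X a) w.
  by rewrite inner_suml; apply: eq_bigr => a _; rewrite innerZl.
have Ea : inner acc (X d) = \sum_l inner (X d) (X l) * ddc l
    + \sum_a \sum_b dc a * dc b * inner (H a b) (X d).
  rewrite inner_suml -big_split; apply: eq_bigr => a _ /=.
  rewrite innerDl !innerZl (innerC (X d)) inner_suml mulrC; congr (_ + _).
  rewrite mulr_sumr; apply: eq_bigr => b _.
  by rewrite innerZl (H_sym b a) mulrA.
rewrite innerBl innerDl !innerZl Ea !Ev (innerC K) Ev.
have -> : \sum_a dc a * inner (X a) vel
    = \sum_a \sum_b dc a * dc b * inner (X a) (X b).
  apply: eq_bigr => a _; rewrite innerC Ev mulr_sumr; apply: eq_bigr => b _.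
  by rewrite mulrA (innerC (X b)).
rewrite -[2 * _ * _]mulrA quadratic_sum double_sum_sym -!addrA mulrDr.
congr (_ + _); first rewrite mulr_sumr; first by apply: eq_bigr => l _; rewrite mulrA.
rewrite mulr_suml -sumrN -!big_split mulr_sumr /=.
apply: eq_bigr => a _; rewrite mulr_suml -sumrN -!big_split mulr_sumr /=.
apply: eq_bigr => b _.
rewrite /dh /conformal_metric_derive (H_sym d a) (H_sym d b) (H_sym b a).
rewrite (innerC (H a d)) (innerC (X a) K) (innerC (X b) K).
by field.
Qed.

Definition lowered_geodesic : Prop :=
  forall d, inner (acc + (2 * inner K vel) *: vel - inner vel vel *: K) (X d) = 0.

(** Multiplication by the metric matrix lowers the index reversibly. *)
Lemma christoffel_geodesicP (Gam : 'I_k -> 'I_k -> 'I_k -> R) :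
  (forall a b l, Gam a b l = 2^-1 * \sum_d
      invmx (L *: gram X) l d * (dh a b d + dh b a d - dh d a b)) ->
  (forall l, ddc l + \sum_a \sum_b Gam a b l * dc a * dc b = 0) <->
  lowered_geodesic.
Proof.
move=> GamE; pose h := L *: gram X.
have h_unit : h \in unitmx.
  by rewrite unitmxZ// unitfE.
pose C : 'cV[R]_k := \col_l ddc l.
pose S : 'cV[R]_k := \col_d
  \sum_a \sum_b 2^-1 * (dh a b d + dh b a d - dh d a b) * dc a * dc b.
have lhsE l : ddc l + \sum_a \sum_b Gam a b l * dc a * dc b
    = (C + invmx h *m S) l 0.
  rewrite !mxE; congr (_ + _).
  rewrite [RHS](eq_bigr (fun d => \sum_a \sum_b invmx h l d *
      (2^-1 * (dh a b d + dh b a d - dh d a b) * dc a * dc b))); last first.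
    move=> d _; rewrite mxE mulr_sumr; apply: eq_bigr => a _.
    by rewrite mulr_sumr.
  rewrite [RHS]exchange_big; apply: eq_bigr => a _ /=.
  rewrite [RHS]exchange_big; apply: eq_bigr => b _ /=.
  rewrite GamE -/h mulr_sumr !mulr_suml; apply: eq_bigr => d _.
  by rewrite !mulrA [_ * 2^-1]mulrC.
have rhsE d : (h *m C + S) d 0 = L *
    inner (acc + (2 * inner K vel) *: vel - inner vel vel *: K) (X d).
  rewrite -lowered_geodesic_term !mxE; congr (_ + _).
  by apply: eq_bigr => l _; rewrite !mxE.
split=> [geo d|low l].
  apply: (mulfI L_neq0); rewrite mulr0 -rhsE.
  suff -> : h *m C + S = 0 by rewrite mxE.
  have -> : S = h *m (invmx h *m S) by rewrite mulmxA mulmxV// mul1mx.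
  rewrite -mulmxDr; suff -> : C + invmx h *m S = 0 by rewrite mulmx0.
  by apply/matrixP => l j; rewrite [j]ord1 -lhsE geo mxE.
rewrite lhsE.
have -> : C = invmx h *m (h *m C) by rewrite mulmxA mulVmx// mul1mx.
rewrite -mulmxDr; suff -> : h *m C + S = 0 by rewrite mulmx0 mxE.
by apply/matrixP => d j; rewrite [j]ord1 rhsE low mulr0 mxE.
Qed.

End ChristoffelAlgebra.

Section ThreeSphereFrame.
Variable R : realType.

Lemma inner_mxvec m (v w : 'M[R]_(2, m)) :
  (mxvec v *m (mxvec w)^T) 0 0 = inner v w.
Proof.
rewrite mxE (reindex _ (curry_mxvec_bij _ _)) /=.
rewrite [RHS]pair_bigA /=; apply: eq_bigr => -[i j] _ /=.
by rewrite mxE !mxvecE.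
Qed.

(** Three independent vectors tangent to the unit sphere of [C^2] at [p] span
its tangent space, by a dimension count. *)
Lemma orth_tangent_frame (p : 'M[R]_(2, 2)) (X : 'I_3 -> 'M[R]_(2, 2)) Y :
  inner p p = 1 -> (forall d, inner p (X d) = 0) ->
  (forall v : 'rV[R]_3, \sum_d v 0 d *: X d = 0 -> v = 0) ->
  (forall d, inner Y (X d) = 0) <-> exists a : R, Y = a *: p.
Proof.
move=> p1 pX X_free; split=> [YX|[a -> d]]; last by rewrite innerZl pX mulr0.
pose B : 'M[R]_(1 + 3, 2 * 2) := col_mx (mxvec p) (\matrix_d mxvec (X d)).
have B_free : row_free B.
  rewrite -kermx_eq0; apply/rowV0P => u /sub_kermxP uB.
  have uE : u = row_mx (lsubmx u) (rsubmx u) by rewrite hsubmxK.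
  have comb : lsubmx u 0 0 *: p + \sum_d (rsubmx u) 0 d *: X d = 0.
    apply: (can_inj mxvecK); rewrite linear0 -uB [in RHS]uE mul_row_col.
    rewrite linearD linearZ /= linear_sum /=; congr (_ + _).
      by rewrite [in RHS](mx11_scalar (lsubmx u)) mul_scalar_mx.
    rewrite mulmx_sum_row; apply: eq_bigr => d _.
    by rewrite linearZ rowK !mxE.
  have u0 : lsubmx u 0 0 = 0.
    have := congr1 (inner p) comb; rewrite innerDr innerZr p1 mulr1 inner0r.
    rewrite inner_sumr big1 ?addr0// => d _.
    by rewrite innerZr pX mulr0.
  move: comb; rewrite u0 scale0r add0r => /X_free ru0.
  rewrite uE ru0 [lsubmx u]mx11_scalar u0 -row_mx0; congr row_mx.
  by apply/matrixP => i j; rewrite !mxE mul0rn.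
have B_full : row_full B by move: B_free; rewrite /row_free /row_full.
pose Z := Y - inner Y p *: p.
have Zp : inner Z p = 0 by rewrite innerBl innerZl p1 mulr1 subrr.
have ZX d : inner Z (X d) = 0 by rewrite innerBl innerZl YX pX mulr0 subrr.
have BZ : B *m (mxvec Z)^T = 0.
  rewrite mul_col_mx; apply: etrans (col_mx0 _ _ _ _); congr col_mx; apply/matrixP => i j.
    by rewrite [i]ord1 [j]ord1 inner_mxvec innerC Zp mxE.
  rewrite [j]ord1 [RHS]mxE -(ZX i) innerC -inner_mxvec !mxE.
  by apply: eq_bigr => k _; rewrite !mxE.
have Z0 : Z = 0.
  apply/eqP; rewrite -inner_eq0 -inner_mxvec.
  have /submxP [C ZC] := submx_full (mxvec Z) B_full.
  by rewrite {1}ZC -mulmxA BZ mulmx0 mxE.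
by exists (inner Y p); apply/eqP; rewrite -subr_eq0 -/Z Z0.
Qed.

End ThreeSphereFrame.

Section Weight.
Variables (R : realType) (k1 k2 : nat).
Implicit Types p : 'M[R]_(2, 2).

Definition weight p : R :=
  inner (col 0 p) (col 0 p) ^+ k1 * inner (col 1 p) (col 1 p) ^+ k2.

Definition weight_regular p : Prop :=
  ((0 < k1)%N -> col 0 p != 0) /\ ((0 < k2)%N -> col 1 p != 0).

Lemma weight_gt0 p : weight_regular p -> 0 < weight p.
Proof.
have h k (z : 'cV[R]_2) : ((0 < k)%N -> z != 0) -> 0 < inner z z ^+ k.
  by case: k => [|k] // /(_ isT); rewrite -inner_gt0 => z0; rewrite exprn_gt0.
by move=> [h1 h2]; rewrite mulr_gt0 ?h.
Qed.

Lemma is_derive_pow (V : normedModType R) (f : V -> R) (x v : V) df k :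
  is_derive x v f df ->
  is_derive x v (fun y => f y ^+ k) (k%:R * f x ^+ k.-1 * df).
Proof.
move=> hf; elim: k => [|k IHk].
  by rewrite !mul0r; exact: is_derive_cst.
have -> : (fun y => f y ^+ k.+1) = (fun y => f y * f y ^+ k).
  by apply/funext => y; rewrite exprS.
apply: is_derive_eq (is_derive_prod hf IHk) _.
case: k {IHk} => [|k] /=; first by rewrite !expr0; ring.
by rewrite -[k.+2%:R]natr1 exprS; ring.
Qed.

Lemma is_derive_norm_pow (V : normedModType R) (F : V -> 'cV[R]_2) (x v : V) dF k :
  ((0 < k)%N -> F x != 0) -> is_derive x v F dF ->
  is_derive x v (fun y => inner (F y) (F y) ^+ k)
    (2 * inner (F x) (F x) ^+ k * (k%:R / inner (F x) (F x) * inner (F x) dF)).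
Proof.
move=> F0 hF; apply: is_derive_eq (is_derive_pow k (is_derive_inner hF hF)) _.
rewrite (innerC dF); case: k F0 => [|k] /=; first by rewrite !mul0r mulr0.
move=> /(_ isT); rewrite -inner_eq0; set n := inner (F x) (F x) => n0.
by rewrite exprS; field.
Qed.

(** The factor 2 is the one of [|z|^2]: the logarithmic derivative of the weight
is twice [half_log_gradient]. *)
Lemma is_derive_weight (V : normedModType R) (F : V -> 'M[R]_(2, 2)) (x v : V) dF :
  weight_regular (F x) -> is_derive x v F dF ->
  is_derive x v (fun y => weight (F y))
    (2 * weight (F x) * inner (half_log_gradient k1 k2 (F x)) dF).
Proof.
move=> [r0 r1] hF; have h0 := is_derive_norm_pow (F := fun y => col 0 (F y)) r0 (is_derive_col 0 hF).
have h1 := is_derive_norm_pow (F := fun y => col 1 (F y)) r1 (is_derive_col 1 hF).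
apply: is_derive_eq (is_derive_prod h0 h1) _.
have [K0 K1] := col_half_log_gradient k1 k2 (F x).
rewrite inner_cols K0 K1 !innerZl /weight; ring.
Qed.

End Weight.

Lemma derive_comm_mx (R : realType) (V : normedModType R) (U : set V) m n
    (F : V -> 'M[R]_(m, n)) (x a b : V) :
  open U -> smooth_on U F -> U x -> 'D_a ('D_b F) x = 'D_b ('D_a F) x.
Proof.
move=> oU sF Ux; have sFij i j : smooth_on U (fun y => F y i j).
  by move=> k; have /(Cn_on_mxP oU) := sF k; exact.
have entry v w i j : 'D_v ('D_w F) x i j = 'D_v ('D_w (fun y => F y i j)) x.
  have /is_derive_mxP /(_ i j) [_ <-] := smooth_on_is_derive v (smooth_on_derive w sF) Ux.
  apply: derive_eq_on oU Ux _ => y Uy.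
  by have /is_derive_mxP /(_ i j) [_ <-] := smooth_on_is_derive w sF Uy.
apply/matrixP => i j; apply: etrans (entry a b i j) _.
by apply: etrans (esym (entry b a i j)); exact: (derive_comm oU (sFij i j)).
Qed.

(** The geodesic equation of the weighted metric, read in the ambient space:
the covariant acceleration has no component tangent to the sphere. *)
Definition weighted_geodesic_at (R : realType) (k1 k2 : nat)
    (sigma : R -> 'M[R]_(2, 2)) (r : R) : Prop :=
  let v := 'D_1 sigma r in
  let K := half_log_gradient k1 k2 (sigma r) in
  exists a : R,
    'D_1 ('D_1 sigma) r + (2 * inner K v) *: v - inner v v *: K = a *: sigma r.

Section GeodesicEquation.
Variables (R : realType) (k1 k2 : nat).
Variables (U : set 'rV[R]_3) (psi : 'rV[R]_3 -> 'M[R]_(2, 2)).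
Variables (N : set R) (c : R -> 'rV[R]_3) (sigma : R -> 'M[R]_(2, 2)).
Hypotheses (oU : open U) (spsi : smooth_on U psi).
Hypothesis psi_sphere : forall u, U u -> inner (psi u) (psi u) = 1.
Hypothesis psi_imm : forall u v, U u -> 'D_v psi u = 0 -> v = 0.
Hypotheses (oN : open N) (sc : smooth_on N c).
Hypothesis cU : forall s, N s -> U (c s).
Hypothesis sigmaE : forall s, N s -> sigma s = psi (c s).

Lemma velocity_in_coords s : N s ->
  'D_1 sigma s = \sum_a ('D_1 c s) 0 a *: partial a psi (c s).
Proof.
move=> Ns; rewrite (derive_eq_on (1 : R) oN Ns sigmaE).
have dc := smooth_on_diff sc Ns; have dpsi := smooth_on_diff spsi (cU Ns).
have [_ ->] := is_derive_comp (1 : R) dc dpsi.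
exact: derive_partial.
Qed.

Lemma acceleration_in_coords s : N s ->
  'D_1 ('D_1 sigma) s = \sum_a (('D_1 ('D_1 c) s) 0 a *: partial a psi (c s) +
    ('D_1 c s) 0 a *: \sum_b ('D_1 c s) 0 b *: partial b (partial a psi) (c s)).
Proof.
move=> Ns; rewrite (derive_eq_on (1 : R) oN Ns velocity_in_coords).
apply: derive_val; apply: is_derive_sumf => a.
have dc := smooth_on_diff sc Ns.
have dpsi := smooth_on_diff (smooth_on_derive (delta_mx 0 a) spsi) (cU Ns).
rewrite -derive_partial//; apply: is_derive_scalef.
  have /is_derive_mxP := smooth_on_is_derive (1 : R) (smooth_on_derive (1 : R) sc) Ns.
  exact.
exact: is_derive_comp.
Qed.

(** The coordinate equation does not depend on the chart: lowering the index gives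
orthogonality of the ambient expression to the coordinate frame, whose
orthogonal complement is the radial line. *)
Lemma geodesic_equation_weightedP r : N r -> weight_regular k1 k2 (sigma r) ->
  geodesic_equation (metric_in_coords (weighted_metric k1 k2) psi) c r <->
  weighted_geodesic_at k1 k2 sigma r.
Proof.
move=> Nr; have Ur := cU Nr; rewrite /weighted_geodesic_at (sigmaE Nr) => reg.
rewrite (acceleration_in_coords Nr) (velocity_in_coords Nr).
pose X a := partial a psi (c r).
pose H a b := partial a (partial b psi) (c r).
pose K := half_log_gradient k1 k2 (psi (c r)).
pose L := weight k1 k2 (psi (c r)).
have L0 : L != 0 by rewrite gt_eqF// weight_gt0.
have H_sym a b : H a b = H b a by exact: derive_comm_mx oU spsi Ur.
have dpsi := smooth_on_diff spsi Ur.
have X_free (v : 'rV[R]_3) : \sum_d v 0 d *: X d = 0 -> v = 0.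
  by rewrite -derive_partial//; exact: psi_imm.
have gX : gram X \in unitmx by exact: gram_unit.
have pX d : inner (psi (c r)) (X d) = 0.
  exact: (sphere_orth_derive oU spsi psi_sphere).
have hE : metric_in_coords (weighted_metric k1 k2) psi (c r) = L *: gram X.
  by apply/matrixP => a b; rewrite !mxE.
have dhE d a b : partial d (fun x => metric_in_coords (weighted_metric k1 k2) psi x a b) (c r)
    = conformal_metric_derive X H K L d a b.
  have -> : (fun x => metric_in_coords (weighted_metric k1 k2) psi x a b) =
      (fun x => weight k1 k2 (psi x) * inner (partial a psi x) (partial b psi x)).
    by apply/funext => x; rewrite mxE.
  apply: derive_val; apply: is_derive_prod.
    apply: is_derive_weight => //; exact: smooth_on_is_derive spsi Ur.
  by apply: is_derive_inner;
    apply: smooth_on_is_derive Ur; exact: smooth_on_derive spsi.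
rewrite /geodesic_equation.
have GamE a b l : christoffel (metric_in_coords (weighted_metric k1 k2) psi) (c r) a b l
  = 2^-1 * \sum_d invmx (L *: gram X) l d *
     (conformal_metric_derive X H K L a b d + conformal_metric_derive X H K L b a d
      - conformal_metric_derive X H K L d a b).
  rewrite /christoffel hE; congr (_ * _); apply: eq_bigr => d _.
  by rewrite !dhE.
have geoP := christoffel_geodesicP (fun a => 'D_1 c r 0 a) (fun a => 'D_1 ('D_1 c) r 0 a)
  H_sym L0 gX GamE.
have spanP := orth_tangent_frame _ (psi_sphere Ur) pX X_free.
have dcE : derive1 c = 'D_1 c by apply/funext => s; rewrite derive1E.
rewrite dcE derive1E.
exact: iff_trans geoP (spanP _).
Qed.

End GeodesicEquation.

(** * Stereographic charts *)

Section Stereographic.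
Variables (R : realType) (p : 'M[R]_(2, 2)).
Hypothesis p_unit : inner p p = 1.

Definition quaternion_j : 'M[R]_(2, 2) :=
  \matrix_(i, j) (if i == 0 then (if j == 0 then - p 0 1 else p 0 0)
                  else (if j == 0 then p 1 1 else - p 1 0)).

(** The quaternionic tangent frame [i p, j p, k p] of the three-sphere at [p]. *)
Definition sphere_frame (i : 'I_3) : 'M[R]_(2, 2) :=
  match nat_of_ord i with
  | 0%N => mulJ p
  | 1%N => quaternion_j
  | _ => mulJ quaternion_j
  end.

Let e := sphere_frame.

Lemma inner22E (v w : 'M[R]_(2, 2)) : inner v w =
  v 0 0 * w 0 0 + v 1 0 * w 1 0 + v 0 1 * w 0 1 + v 1 1 * w 1 1.
Proof. by rewrite innerE sum_ord2; ring. Qed.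

Lemma sum_ord3 (V : nmodType) (F : 'I_3 -> V) :
  \sum_i F i = F 0 + F 1 + F (inord 2).
Proof.
rewrite !big_ord_recl big_ord0 addr0 addrA; congr (_ + F _ + F _).
  exact: val_inj.
by apply: val_inj; rewrite /= inordK.
Qed.

Lemma ord3P (P : 'I_3 -> Prop) : P 0 -> P 1 -> P (inord 2) -> forall i, P i.
Proof.
move=> P0 P1 P2 [[|[|[|//]]] hi].
- by have -> : Ordinal hi = 0 by apply: val_inj.
- by have -> : Ordinal hi = 1 by apply: val_inj.
- by have -> : Ordinal hi = inord 2 by apply: val_inj; rewrite /= inordK.
Qed.

Lemma frame_values : [/\ e 0 = mulJ p, e 1 = quaternion_j &
  e (inord 2) = mulJ quaternion_j].
Proof. by split; rewrite /e /sphere_frame ?inordK. Qed.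

Lemma p_unitE : p 0 0 ^+ 2 + p 1 0 ^+ 2 + p 0 1 ^+ 2 + p 1 1 ^+ 2 = 1.
Proof. by rewrite -[RHS]p_unit inner22E !expr2. Qed.

Lemma frame_tangent i : inner p (e i) = 0.
Proof.
have [e0 e1 e2] := frame_values.
by move: i; apply: ord3P; rewrite ?e0 ?e1 ?e2 inner22E !mxE /=; ring.
Qed.

Lemma frame_orthonormal i j : inner (e i) (e j) = (i == j)%:R.
Proof.
have [e0 e1 e2] := frame_values; have p1 := p_unitE.
move: i j; apply: ord3P; apply: ord3P;
  rewrite ?e0 ?e1 ?e2 ?eqxx -?val_eqE /= ?inordK //= inner22E !mxE /= -?p1; ring.
Qed.

Lemma frame_expansion w :
  w = inner w p *: p + \sum_i inner w (e i) *: e i.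
Proof.
have [e0 e1 e2] := frame_values; rewrite sum_ord3 e0 e1 e2 !inner22E.
have p1 := p_unitE; apply/matrixP => i j; rewrite -[w in LHS]scale1r -p1.
by case: (ord2P i) => ->; case: (ord2P j) => ->; rewrite !mxE /=; ring.
Qed.

Definition sqnorm (u : 'rV[R]_3) : R := \sum_i u 0 i ^+ 2.
Definition tangent_comb (u : 'rV[R]_3) : 'M[R]_(2, 2) := \sum_i u 0 i *: e i.

(** Inverse stereographic projection from [- p]: a rational chart centred at
[p]. *)
Definition stereo_inv (u : 'rV[R]_3) : 'M[R]_(2, 2) :=
  (1 + sqnorm u)^-1 *: ((1 - sqnorm u) *: p + 2 *: tangent_comb u).

Definition stereo (w : 'M[R]_(2, 2)) : 'rV[R]_3 :=
  \row_i (inner w (e i) / (1 + inner w p)).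

Lemma sqnorm_ge0 u : 0 <= sqnorm u.
Proof. by apply: sumr_ge0 => i _; exact: sqr_ge0. Qed.

Lemma sqnorm1_neq0 u : 1 + sqnorm u != 0.
Proof. by rewrite gt_eqF// ltr_pwDl// sqnorm_ge0. Qed.

Lemma inner_comb_p u : inner (tangent_comb u) p = 0.
Proof.
rewrite inner_suml big1// => i _.
by rewrite innerZl innerC frame_tangent mulr0.
Qed.

Lemma inner_comb_frame u i : inner (tangent_comb u) (e i) = u 0 i.
Proof.
rewrite inner_suml (bigD1 i)//= innerZl frame_orthonormal eqxx mulr1.
rewrite big1 ?addr0// => j ji.
by rewrite innerZl frame_orthonormal (negbTE ji) mulr0.
Qed.

Lemma inner_comb_comb u : inner (tangent_comb u) (tangent_comb u) = sqnorm u.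
Proof.
rewrite inner_sumr; apply: eq_bigr => i _.
by rewrite innerZr inner_comb_frame expr2.
Qed.

Lemma inner_stereo_inv_p u : 1 + inner (stereo_inv u) p = 2 / (1 + sqnorm u).
Proof.
rewrite innerZl innerDl !innerZl inner_comb_p p_unit; field.
exact: sqnorm1_neq0.
Qed.

(** This polynomial relation recovers [u] from [stereo_inv u]; differentiating it
shows that the chart is immersed. *)
Lemma inner_stereo_inv_frame u i :
  inner (stereo_inv u) (e i) = u 0 i * (1 + inner (stereo_inv u) p).
Proof.
rewrite inner_stereo_inv_p innerZl innerDl !innerZl inner_comb_frame frame_tangent.
by field; exact: sqnorm1_neq0.
Qed.

Lemma stereo_inv_sphere u : usphere (stereo_inv u).
Proof.
rewrite /usphere /= innerZl innerZr innerDl !innerDr !innerZl !innerZr.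
rewrite inner_comb_comb inner_comb_p innerC innerC p_unit (innerC p) inner_comb_p.
by field; exact: sqnorm1_neq0.
Qed.

Lemma stereoK u : stereo (stereo_inv u) = u.
Proof.
apply/matrixP => i j; rewrite [i]ord1 mxE inner_stereo_inv_frame mulfK//.
by rewrite inner_stereo_inv_p mulf_neq0 ?pnatr_eq0// invr_neq0// sqnorm1_neq0.
Qed.

Lemma stereo_invK w : usphere w -> 1 + inner w p != 0 -> stereo_inv (stereo w) = w.
Proof.
rewrite /usphere /= => w1; set s := inner w p => s0.
have sum_t : \sum_i inner w (e i) ^+ 2 = 1 - s ^+ 2.
  rewrite -[1 in RHS]w1 [w in inner _ w](frame_expansion w) innerDr innerZr.
  rewrite -/s -expr2 addrC addKr inner_sumr; apply: eq_bigr => i _.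
  by rewrite innerZr expr2.
have Qe : sqnorm (stereo w) = (1 - s) / (1 + s).
  rewrite /sqnorm (eq_bigr (fun i => (1 + s) ^- 2 * inner w (e i) ^+ 2)).
    by rewrite -mulr_sumr sum_t; field.
  by move=> i _; rewrite mxE exprMn -/s mulrC exprVn.
rewrite [RHS]frame_expansion /stereo_inv Qe.
have Te : tangent_comb (stereo w) = (1 + s)^-1 *: \sum_i inner w (e i) *: e i.
  rewrite scaler_sumr; apply: eq_bigr => i _.
  by rewrite mxE scalerA mulrC.
have n2 : (2 : R) != 0 by rewrite pnatr_eq0.
have Q1 : 1 + (1 - s) / (1 + s) = 2 / (1 + s) by field.
rewrite Te scalerDr !scalerA Q1 -/s; congr (_ *: _ + _).
  by field; rewrite s0.
by rewrite -[RHS]scale1r; congr (_ *: _); field; rewrite s0.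
Qed.

Lemma smooth_stereo_inv U : open U -> smooth_on U stereo_inv.
Proof.
move=> oU n; have coordC i : Cn_on n U (fun u : 'rV[R]_3 => u 0 i).
  by have /(Cn_on_mxP oU) := Cn_on_id U n; exact.
have QC : Cn_on n U sqnorm by apply: (Cn_on_sum oU) => i; apply: (Cn_onX oU); exact: coordC.
have cst1 : Cn_on n U (fun=> (1 : R)) by exact: smooth_on_cst.
apply: Cn_onZ => //.
  by apply: Cn_onV => // [u _|]; [exact: sqnorm1_neq0|exact: Cn_onD].
apply: Cn_onD => //.
  apply: Cn_onZ => //; last exact: smooth_on_cst.
  apply: Cn_onD => //.
  apply: (Cn_on_eq oU (f := fun u => -1 * sqnorm u)) => [u _|].
    by rewrite mulN1r.
  by apply: Cn_onM => //; exact: smooth_on_cst.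
apply: Cn_onZ => //; first exact: smooth_on_cst.
apply: Cn_on_sum => // i; apply: Cn_onZ => //; exact: smooth_on_cst.
Qed.

Lemma stereo_inv_immersed u v : 'D_v stereo_inv u = 0 -> v = 0.
Proof.
move=> D0; have oT : open [set: 'rV[R]_3] by exact: openT.
have hpsi := smooth_on_is_derive v (smooth_stereo_inv oT) (I : [set: _] u).
move: hpsi; rewrite D0 => hpsi.
have hcst (w : 'M[R]_(2, 2)) : is_derive u v (fun=> w) 0 by exact: is_derive_cst.
apply/matrixP => i j; rewrite [i]ord1 [RHS]mxE {i}.
have hl := is_derive_inner hpsi (hcst (e j)).
have hid : is_derive u v (fun y : 'rV[R]_3 => y 0 j) (v 0 j).
  by have /is_derive_mxP := is_derive_id u v; exact.
have hr := is_derive_prod hid (is_derive_plus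
  (is_derive_cst (1 : R) u v) (is_derive_inner hpsi (hcst p))).
have fE : (fun y => inner (stereo_inv y) (e j)) =
    (fun y => y 0 j * (cst 1 y + inner (stereo_inv y) p)).
  by apply/funext => y; rewrite inner_stereo_inv_frame.
have := @derive_val _ _ _ _ _ _ _ hl; rewrite fE (@derive_val _ _ _ _ _ _ _ hr).
rewrite !inner0l !inner0r !addr0 mulr0 addr0 => /eqP.
rewrite mulf_eq0 => /orP[/eqP //|].
rewrite /cst inner_stereo_inv_p mulf_eq0 pnatr_eq0 invr_eq0.
by rewrite (negbTE (sqnorm1_neq0 u)).
Qed.

Lemma stereo_parametrization : S3_parametrization [set: 'rV[R]_3] stereo_inv.
Proof.
split.
- exact: openT.
- exact: smooth_stereo_inv openT.
- by move=> u _; exact: stereo_inv_sphere.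
- by move=> u u' _ _ /(congr1 stereo); rewrite !stereoK.
- by move=> u v _; exact: stereo_inv_immersed.
Qed.

Lemma smooth_stereo_comp (N : set R) (sigma : R -> 'M[R]_(2, 2)) :
  open N -> smooth_on N sigma -> (forall r, N r -> 1 + inner (sigma r) p != 0) ->
  smooth_on N (fun r => stereo (sigma r)).
Proof.
move=> oN ss s0 n; apply/(Cn_on_mxP oN) => i j.
apply: (Cn_on_eq oN (f := fun r => inner (sigma r) (e j) * (1 + inner (sigma r) p)^-1)).
  by move=> r _; rewrite mxE.
have innerC' w : Cn_on n N (fun r => inner (sigma r) w).
  by apply: Cn_on_inner => //; exact: smooth_on_cst.
apply: Cn_onM => //; apply: Cn_onV => //; apply: Cn_onD => //.
exact: smooth_on_cst.
Qed.

End Stereographic.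

(** * Parametrization at prescribed speed *)

Section Primitive.
Variables (R : realType) (I : set R) (w : R -> R) (t0 : R).
Hypotheses (oI : open I) (iI : is_interval I) (It0 : I t0).
Hypothesis cw : forall t, I t -> {for t, continuous w}.
Let mu := @lebesgue_measure R.

Definition oriented_integral (t : R) : R :=
  if t0 <= t then \int[mu]_(x in `]t0, t]) w x
  else - \int[mu]_(x in `]t, t0]) w x.

Lemma open_interval_extend t : I t -> exists a b : R, [/\ a < t, t < b, I a & I b].
Proof.
move=> It; have /nbhs_ballP [e /= e0 eI] : nbhs t I by exact: open_nbhs_nbhs.
have e2 : 0 < e / 2 by rewrite divr_gt0.
have e2e : e / 2 < e by rewrite ltr_pdivrMr// ltr_pMr// ltr1n.
exists (t - e / 2), (t + e / 2); split.
- by rewrite ltrBlDr ltrDl.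
- by rewrite ltrDl.
- by apply: eI; rewrite -ball_normE /= opprB addrC subrK gtr0_norm.
- by apply: eI; rewrite -ball_normE /= opprD addNKr normrN gtr0_norm.
Qed.

Lemma segment_integrable a b : I a -> I b -> mu.-integrable `[a, b] (EFin \o w).
Proof.
move=> Ia Ib; apply: continuous_compact_integrable; first exact: segment_compact.
apply: continuous_in_subspaceT => x /[!inE] /= /[!in_itv] /= xab.
by apply: cw; exact: iI Ia Ib _ xab.
Qed.

(** Rewriting the oriented integral with a common lower bound makes the
fundamental theorem applicable on both sides of the base point. *)
Lemma oriented_integralE a t : I a -> I t -> a < t0 -> a < t ->
  oriented_integral t =
  (\int[mu]_(x in `[a, t]) w x) - (\int[mu]_(x in `[a, t0]) w x).
Proof.
move=> Ia It at0 at_; rewrite /oriented_integral; case: (leP t0 t) => tt0.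
  rewrite Rintegral_itvB ?bnd_simp ?(ltW at0)//.
  exact: segment_integrable.
rewrite -[RHS]opprB Rintegral_itvB ?bnd_simp ?(ltW at_) ?(ltW tt0)//.
exact: segment_integrable.
Qed.

(** The base point and [t] are compared from a point of the interval to the left of
both. *)
Lemma is_derive_oriented_integral t : I t ->
  is_derive t (1 : R) oriented_integral (w t).
Proof.
move=> It.
have [a [b [amin bt Ia Ib]]] : exists a b : R, [/\ a < Num.min t0 t, t < b, I a & I b].
  have [a [_ [am _ Ia _]]] : exists a b : R,
      [/\ a < Num.min t0 t, Num.min t0 t < b, I a & I b].
    by apply: open_interval_extend; rewrite /Num.min; case: ifP.
  have [_ [b [_ tb _ Ib]]] := open_interval_extend It.
  by exists a, b.
move: amin; rewrite lt_min => /andP[at0 at_].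
have [dF F'] := continuous_FTC1_closed bt (segment_integrable Ia Ib) at_ (cw It).
pose c := \int[mu]_(x in `[a, t0]) w x.
have hF : is_derive t (1 : R) (fun y => (\int[mu]_(x in `[a, y]) w x) - c) (w t).
  have hI : is_derive t (1 : R) (fun y => \int[mu]_(x in `[a, y]) w x) (w t).
    by split; [exact: dF|rewrite -derive1E; exact: F'].
  rewrite -[w t]subr0; exact: (is_deriveB hI (is_derive_cst c t (1 : R))).
apply: near_eq_is_derive hF; near=> y; apply/esym/oriented_integralE => //.
  by near: y; exact: open_nbhs_nbhs.
by near: y; exact: lt_nbhsr.
Unshelve. all: by end_near. Qed.

End Primitive.

(** A positive speed integrates to a diffeomorphism of intervals, whose inverse
is the change of parameter with velocity the inverse speed. *)
Lemma unit_speed_parameter (R : realType) (I : set R) (w : R -> R) :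
  open I -> is_interval I -> I !=set0 -> smooth_on I w ->
  (forall t, I t -> 0 < w t) ->
  exists (J : set R) (tau : R -> R),
    [/\ open J /\ is_interval J, smooth_on J tau, tau @` J = I &
        forall s, J s -> is_derive s (1 : R) tau (w (tau s))^-1].
Proof.
move=> oI iI [t0 It0] sw w_gt0.
have cw t : I t -> {for t, continuous w} by exact: (sw 0%N).
pose L := oriented_integral w t0.
have dL t : I t -> is_derive t (1 : R) L (w t).
  exact: is_derive_oriented_integral.
have cL t : I t -> {for t, continuous L}.
  move=> It; apply/differentiable_continuous/derivable1_diffP.
  by case: (dL t It).
have seg x y : I x -> I y -> {within `[x, y], continuous L}.
  move=> Ix Iy; apply: continuous_in_subspaceT => z /[!inE] /= /[!in_itv] /= zxy.
  by apply: cL; exact: iI Ix Iy _ zxy.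
have L_lt x y : I x -> I y -> x < y -> L x < L y.
  move=> Ix Iy xy.
  have itvI z : z \in `]x, y[%R -> I z.
    by rewrite in_itv /= => /andP[xz zy]; apply: (iI x y) => //; rewrite !ltW.
  have [|z zxy E] := @MVT _ L w x y xy _ (seg _ _ Ix Iy).
    by move=> z /itvI; exact: dL.
  by rewrite -subr_gt0 E mulr_gt0 ?subr_gt0//; apply: w_gt0; exact: itvI.
have L_inj x y : I x -> I y -> L x = L y -> x = y.
  move=> Ix Iy Lxy; case: (ltgtP x y) => // /L_lt => [/(_ Ix Iy)|/(_ Iy Ix)];
  by rewrite Lxy ltxx.
(* The default value [t0] is never met on [J]. *)
pose J := L @` I; pose tau s := xget t0 [set t | I t /\ L t = s].
have tauL t : I t -> tau (L t) = t.
  move=> It; rewrite /tau; case: xgetP => [x _ [Ix Lx]|/(_ t)]; first exact: L_inj.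
  by case.
have tauJ s : J s -> I (tau s) by move=> [t It <-]; rewrite tauL.
have iJ : is_interval J.
  move=> _ _ [x Ix <-] [y Iy <-] s /andP[xs sy].
  have xy : x <= y by rewrite leNgt; apply/negP => /(L_lt _ _ Iy Ix);
    rewrite ltNge (le_trans xs sy).
  have [|z zxy <-] := @IVT _ L x y s xy (seg _ _ Ix Iy).
    by rewrite ge_min xs/= le_max sy orbT.
  by exists z => //; apply: iI Ix Iy _ _; move: zxy; rewrite in_itv.
have oJ : open J.
  rewrite openE => _ [t It <-]; rewrite /interior.
  have [a [b [at_ tb Ia Ib]]] := open_interval_extend oI It.
  have : \forall s \near L t, s \in `]L a, L b[%R.
    by apply: near_in_itvoo; rewrite in_itv /= !L_lt.
  apply: filterS => s; rewrite in_itv /= => /andP[sa sb].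
  apply: (iJ (L a) (L b)); [by exists a|by exists b|].
  by rewrite !ltW.
have dtau s : J s -> is_derive s (1 : R) tau (w (tau s))^-1.
  move=> [t It <-]; rewrite tauL//; apply: is_derive_inverse.
  - near=> y; apply: tauL; near: y; exact: open_nbhs_nbhs.
  - near=> y; apply: cL; near: y; exact: open_nbhs_nbhs.
  - exact: dL.
  - by rewrite gt_eqF// w_gt0.
exists J, tau; split=> //.
  elim=> [|n IHn].
    move=> s Js; apply/differentiable_continuous/derivable1_diffP.
    by case: (dtau s Js).
  have dif s : J s -> differentiable tau s.
    by move=> Js; apply/derivable1_diffP; case: (dtau s Js).
  split=> [s /dif //|v].
  have hV : Cn_on n J (fun s => (w (tau s))^-1).
    apply: Cn_onV => // [s /tauJ /w_gt0 ws|]; first by rewrite gt_eqF.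
    exact: (Cn_on_comp oJ tauJ (sw n) IHn).
  apply: (Cn_on_eq oJ) (Cn_onM oJ (smooth_on_cst J (v : R) n) hV) => s Js.
  have [_ <-] := dtau s Js.
  by rewrite (derive_real_dir v (dif s Js)).
apply/seteqP; split=> [_ [s Js <-]|t It]; first exact: tauJ.
by exists (L t); [exists t|rewrite tauL].
Unshelve. all: by end_near. Qed.

(** * Change of parameter *)

Section PointwiseCurve.
Variables (R : realType) (m : nat).
Implicit Types q v w K : 'M[R]_(2, m).

Lemma reparametrized_span_bwd q v w K (t1 t2 a c : R) : t1 != 0 -> v != 0 ->
  (t2 *: v + t1 ^+ 2 *: w) + c *: (t1 *: v)
    - inner (t1 *: v) (t1 *: v) *: K = a *: q ->
  exists a' b' : R, (inner v v)^-1 *: w - K = a' *: q + b' *: v.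
Proof.
rewrite -inner_eq0 !innerZl !innerZr; set n := inner v v => t0 n0 E.
exists (a / (t1 ^+ 2 * n)), (- (t2 + c * t1) / (t1 ^+ 2 * n)).
apply/matrixP => i j; move/matrixP: E => /(_ i j); rewrite !mxE => E.
have -> : w i j = (a * q i j - t2 * v i j - c * (t1 * v i j)
    + t1 * (t1 * n) * K i j) / t1 ^+ 2.
  by rewrite -E; field.
by field; rewrite t0 n0.
Qed.

Lemma reparametrized_span_fwd q v w K (t1 t2 a b : R) : t1 != 0 -> v != 0 ->
  (inner v v)^-1 *: w - K = a *: q + b *: v ->
  exists a' b' : R, t2 *: v + t1 ^+ 2 *: w =
    inner (t1 *: v) (t1 *: v) *: K + a' *: q + b' *: (t1 *: v).
Proof.
rewrite -inner_eq0 !innerZl !innerZr; set n := inner v v => t0 n0 E.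
exists (t1 ^+ 2 * n * a), ((t2 + t1 ^+ 2 * n * b) / t1).
apply/matrixP => i j; move/matrixP: E => /(_ i j); rewrite !mxE => E.
have -> : w i j = n * (K i j + a * q i j + b * v i j).
  by rewrite -addrA -E; field.
by field.
Qed.

(** A unit-speed curve for the metric with conformal factor [W], whose
differential is twice [W *: K], has prescribed tangential acceleration. *)
Lemma tangential_acceleration q v w K (W a b : R) :
  inner q v = 0 -> W * inner v v = 1 ->
  2 * W * inner K v * inner v v + W * (inner w v + inner v w) = 0 ->
  w = inner v v *: K + a *: q + b *: v ->
  w + (2 * inner K v) *: v - inner v v *: K = a *: q.
Proof.
move=> qv Wn; rewrite (innerC v w) => tang wE.
have wv : inner w v = inner v v * inner K v + b * inner v v.
  by rewrite {1}wE !innerDl !innerZl qv mulr0 addr0.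
have bE : b = - (2 * inner K v).
  apply/eqP; rewrite -subr_eq0 opprK; apply/eqP.
  have : 2 * (W * inner v v) * (b + 2 * inner K v) = 0 by rewrite -[RHS]tang wv; ring.
  by rewrite Wn mulr1 => /eqP; rewrite mulf_eq0 pnatr_eq0 => /eqP.
rewrite wE bE; move: (inner v v) (inner K v) => n k.
by apply/matrixP => i j; rewrite !mxE; ring.
Qed.

End PointwiseCurve.

Section Reparametrization.
Variables (R : realType) (k1 k2 : nat).
Variables (I J : set R) (g : R -> 'M[R]_(2, 2)) (tau : R -> R).
Hypotheses (oI : open I) (oJ : open J).
Hypotheses (sg : smooth_on I g) (stau : smooth_on J tau).
Hypothesis tauI : forall s, J s -> I (tau s).
Hypothesis g_sphere : forall t, I t -> inner (g t) (g t) = 1.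
Hypothesis g_immersed : forall t, I t -> 'D_1 g t != 0.
Let sigma := g \o tau.

Lemma velocity_comp s : J s -> 'D_1 sigma s = 'D_1 tau s *: 'D_1 g (tau s).
Proof.
move=> Js; have dtau := smooth_on_diff stau Js.
have dg := smooth_on_diff sg (tauI Js).
have [_ ->] := is_derive_comp (1 : R) dtau dg.
exact: derive_real_dir.
Qed.

Lemma smooth_sigma : smooth_on J sigma.
Proof. by move=> n; exact: (Cn_on_comp_mx oJ tauI (sg n) (stau n)). Qed.

Lemma acceleration_comp s : J s -> 'D_1 ('D_1 sigma) s =
  'D_1 ('D_1 tau) s *: 'D_1 g (tau s)
  + 'D_1 tau s ^+ 2 *: 'D_1 ('D_1 g) (tau s).
Proof.
move=> Js; rewrite (derive_eq_on (1 : R) oJ Js velocity_comp).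
have dtau := smooth_on_diff stau Js.
have dg' := smooth_on_diff (smooth_on_derive (1 : R) sg) (tauI Js).
have hcomp := is_derive_comp (1 : R) dtau dg'.
have htau := smooth_on_is_derive (1 : R) (smooth_on_derive (1 : R) stau) Js.
have [_ ->] := is_derive_scalef htau hcomp.
by rewrite (derive_real_dir _ dg') scalerA -expr2.
Qed.

Lemma weighted_geodesic_curvature_free_of s : J s -> 'D_1 tau s != 0 ->
  weighted_geodesic_at k1 k2 sigma s ->
  weighted_geodesic_curvature_free k1 k2 g (tau s).
Proof.
move=> Js t0 [a]; rewrite (acceleration_comp Js) (velocity_comp Js).
exact: reparametrized_span_bwd t0 (g_immersed (tauI Js)).
Qed.

Hypothesis sigma_regular : forall s, J s -> weight_regular k1 k2 (sigma s).
Hypothesis unit_speed : forall s, J s ->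
  weight k1 k2 (sigma s) * inner ('D_1 sigma s) ('D_1 sigma s) = 1.

Lemma sigma_sphere s : J s -> inner (sigma s) (sigma s) = 1.
Proof. by move=> /tauI; exact: g_sphere. Qed.

(** At unit speed the tangential component of the acceleration is determined by
the weight, and it is the one that the geodesic equation requires. *)
Lemma weighted_geodesic_at_unit_speed s : J s -> 'D_1 tau s != 0 ->
  weighted_geodesic_curvature_free k1 k2 g (tau s) ->
  weighted_geodesic_at k1 k2 sigma s.
Proof.
move=> Js t0 [a [b E]].
have hs := smooth_on_is_derive (1 : R) smooth_sigma Js.
have hds := smooth_on_is_derive (1 : R) (smooth_on_derive (1 : R) smooth_sigma) Js.
have hw := is_derive_weight (sigma_regular Js) hs.
have tangential := derive_cst_on oJ Js unit_speed
  (is_derive_prod hw (is_derive_inner hds hds)).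
have orth : inner (sigma s) ('D_1 sigma s) = 0.
  have := derive_cst_on oJ Js sigma_sphere (is_derive_inner hs hs).
  by rewrite innerC -mulr2n => /eqP; rewrite mulrn_eq0 => /eqP.
have [a' [b' accE]] := reparametrized_span_fwd ('D_1 ('D_1 tau) s) t0
  (g_immersed (tauI Js)) E.
exists a'; apply: tangential_acceleration orth (unit_speed Js) tangential _.
by rewrite (acceleration_comp Js) (velocity_comp Js); exact: accE.
Qed.

End Reparametrization.

(** * Unparametrized geodesics *)

(** Every point of a curve solving the ambient form of the geodesic equation
lies in a stereographic chart centred at it, where the coordinate form holds. *)
Lemma geodesic_S3_of_ambient (R : realType) (k1 k2 : nat) (J : set R)
    (sigma : R -> 'M[R]_(2, 2)) :
  open J -> smooth_on J sigma -> (forall s, J s -> usphere (sigma s)) ->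
  (forall s, J s -> weight_regular k1 k2 (sigma s)) ->
  (forall s, J s -> weighted_geodesic_at k1 k2 sigma s) ->
  geodesic_S3 (weighted_metric k1 k2) J sigma.
Proof.
move=> oJ ss sphere reg geo s Js; set p := sigma s.
have p1 : inner p p = 1 by exact: sphere.
pose q r := 1 + inner (sigma r) p.
have cq : {for s, continuous q}.
  have hq : Cn_on 0 J q.
    apply: Cn_onD => //; first exact: (smooth_on_cst J (1 : R) 0%N).
    by apply: (Cn_on_inner oJ); [exact: (ss 0%N)|exact: smooth_on_cst].
  exact: hq.
have q0 : q s != 0 by rewrite /q p1 -(natrD R 1 1) pnatr_eq0.
have near_s : nbhs s (J `&` [set r | q r != 0]).
  apply: filterI; first exact: open_nbhs_nbhs.
  exact: (cvgr_neq0 (q s) cq q0).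
have [N [oN Ns] NJ] : exists2 N, open_nbhs s N & N `<=` J `&` [set r | q r != 0].
  by move: near_s; rewrite nbhsE => -[N]; exists N.
have sN : smooth_on N sigma.
  by move=> n; apply: Cn_on_subset (ss n) => r /NJ [].
exists [set: 'rV[R]_3], (stereo_inv p), N, (fun r => stereo p (sigma r)).
have sst : smooth_on N (fun r => stereo p (sigma r)).
  by apply: smooth_stereo_comp => // r /NJ [].
have inv r : N r -> sigma r = stereo_inv p (stereo p (sigma r)).
  by move=> /NJ [Jr qr]; rewrite stereo_invK//; exact: sphere.
split=> //; first exact: stereo_parametrization.
move=> r Nr; have [Jr _] := NJ _ Nr; split=> //; first exact: inv.
apply/(@geodesic_equation_weightedP _ k1 k2 [set: 'rV[R]_3] (stereo_inv p) N _ sigma) => //.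
- exact: openT.
- by apply: smooth_stereo_inv => //; exact: openT.
- by move=> u _; exact: stereo_inv_sphere.
- by move=> u v _; exact: stereo_inv_immersed.
- exact: reg.
- exact: geo.
Qed.

Section UnparametrizedGeodesics.
Variables (R : realType) (k1 k2 : nat) (I : set R) (g : R -> 'M[R]_(2, 2)).
Hypotheses (oI : open I) (iI : is_interval I) (I0 : I !=set0).
Hypotheses (sg : smooth_on I g).
Hypothesis g_sphere : forall t, I t -> usphere (g t).
Hypothesis g_immersed : forall t, I t -> 'D_1 g t != 0.
Hypothesis g_regular : forall t, I t -> weight_regular k1 k2 (g t).

Let speed2 t := weight k1 k2 (g t) * inner ('D_1 g t) ('D_1 g t).

Lemma speed2_gt0 t : I t -> 0 < speed2 t.
Proof.
by move=> It; rewrite mulr_gt0 ?inner_gt0 ?g_immersed// weight_gt0//; exact: g_regular.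
Qed.

Lemma smooth_speed : smooth_on I (fun t => Num.sqrt (speed2 t)).
Proof.
move=> n; apply: (Cn_on_sqrt oI); first exact: speed2_gt0.
have sg' := smooth_on_derive (1 : R) sg.
apply: (Cn_onM oI); last exact: (Cn_on_inner oI (sg' n) (sg' n)).
apply: (Cn_onM oI); apply: (Cn_onX oI);
  apply: (Cn_on_inner oI); apply: (Cn_on_col oI); exact: sg.
Qed.

(** The curvature condition is the geodesic equation up to a multiple of the
velocity.  That multiple depends on the parametrization and vanishes at unit
speed for the weighted metric, so it suffices to integrate the speed. *)
Lemma unparametrized_geodesicP :
  unparametrized_geodesic_S3 (weighted_metric k1 k2) I g <->
  forall t, I t -> weighted_geodesic_curvature_free k1 k2 g t.
Proof.
split=> [[J [tau [[oJ iJ] stau tau0 tauJ geo]]] t It|free].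
  have tauI s : J s -> I (tau s) by move=> Js; rewrite -tauJ; exists s.
  have [s Js <-] : (tau @` J) t by rewrite tauJ.
  have [U [psi [N [c [[oU spsi psi_sphere _ psi_imm] [oN Ns] sc H]]]]] := geo s Js.
  apply: (@weighted_geodesic_curvature_free_of R k1 k2 I J) => //.
    by rewrite -derive1E; exact: tau0.
  have cU r : N r -> U (c r) by move=> /H [].
  have cE r : N r -> (g \o tau) r = psi (c r) by move=> /H [].
  have [_ _ geq] := H s Ns.
  apply/(@geodesic_equation_weightedP _ k1 k2 U psi N c (g \o tau)) => //.
  exact/g_regular/tauI.
have [|J [tau [[oJ iJ] stau tauJ dtau]]] := unit_speed_parameter oI iI I0 smooth_speed.
  by move=> t It; rewrite sqrtr_gt0 speed2_gt0.
have tauI s : J s -> I (tau s) by move=> Js; rewrite -tauJ; exists s.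
have tau0 s : J s -> 'D_1 tau s != 0.
  move=> Js; have [_ ->] := dtau s Js.
  by rewrite invr_neq0// gt_eqF// sqrtr_gt0 speed2_gt0//; exact: tauI.
have unit_speed s : J s -> weight k1 k2 ((g \o tau) s) *
    inner ('D_1 (g \o tau) s) ('D_1 (g \o tau) s) = 1.
  move=> Js; rewrite (velocity_comp sg stau tauI Js) innerZl innerZr /=.
  have [_ ->] := dtau s Js; have := speed2_gt0 (tauI s Js).
  rewrite /speed2; set W := weight _ _ _; set n := inner _ _ => Wn.
  have : Num.sqrt (W * n) * Num.sqrt (W * n) = W * n.
    by rewrite -expr2 sqr_sqrtr// ltW.
  have : Num.sqrt (W * n) != 0 by rewrite gt_eqF// sqrtr_gt0.
  move: (Num.sqrt _) => r r0 rr; transitivity (W * n / (r * r)); first by field.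
  by rewrite rr divff// gt_eqF.
have ssigma := smooth_sigma oJ sg stau tauI.
exists J, tau; split=> //; first by move=> s Js; rewrite derive1E; exact: tau0.
apply: geodesic_S3_of_ambient => // s Js.
- exact/g_sphere/tauI.
- exact/g_regular/tauI.
apply: (@weighted_geodesic_at_unit_speed R k1 k2 I J) => //.
- by move=> r Jr; exact/g_regular/tauI.
- exact: tau0.
- exact/free/tauI.
Qed.

End UnparametrizedGeodesics.

(** * Charts of manifolds and the theorem *)

Lemma manifold_chart (R : realType) k (M : smoothManifold R k) c :
  atlas M c -> is_chart c.
Proof. by case: M c => T A ? ? A_chart ? ? c; exact: A_chart. Qed.

Lemma manifold_point_chart (R : realType) k (M : smoothManifold R k) :
  [set: M] !=set0 -> exists c u, atlas M c /\ chart_cod c u.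
Proof.
case=> x _; have [c Ac cx] : exists2 c, atlas M c & chart_dom c x.
  by case: M x => T A ? ? ? A_cover ? x; exact: A_cover.
have [_ + _ _ _] := manifold_chart Ac => /(_ x cx) [? _].
by exists c, (coords c x).
Qed.

Section ChartOfSphereMap.
Variables (R : realType) (k m : nat) (M : smoothManifold R k).
Variables (f : M -> 'M[R]_(2, m)) (c : chart R M k).
Hypotheses (f_imm : sphere_immersion (atlas M) f).
Hypotheses (f_real : C_totally_real (atlas M) f) (Ac : atlas M c).

Lemma chart_immersion_data : [/\ open (chart_cod c),
  smooth_on (chart_cod c) (f \o param c),
  forall u, chart_cod c u -> inner ((f \o param c) u) ((f \o param c) u) = 1,
  forall u v, chart_cod c u -> inner (mulJ ((f \o param c) u)) ('D_v (f \o param c) u) = 0 &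
  forall u v, chart_cod c u -> 'D_v (f \o param c) u = 0 -> v = 0].
Proof.
have [[_ oc] _ cod_dom _ _] := manifold_chart Ac; have [sph smo imm] := f_imm Ac.
split=> //; first by move=> u /cod_dom [/sph].
by move=> u v; exact: f_real.
Qed.

End ChartOfSphereMap.

Unset Implicit Arguments.

Theorem theoremA (R : realType) (k1 k2 n1 n2 : nat)
  (M1 : smoothManifold R k1) (M2 : smoothManifold R k2)
  (f1 : M1 -> 'M[R]_(2, n1.+1)) (f2 : M2 -> 'M[R]_(2, n2.+1))
  (I : set R) (gamma : R -> 'M[R]_(2, 2))
  (M1_nonempty : [set: M1] !=set0) (M2_nonempty : [set: M2] !=set0)
  (f1_immersion : sphere_immersion (atlas M1) f1)
  (f2_immersion : sphere_immersion (atlas M2) f2)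
  (f1_totally_real : C_totally_real (atlas M1) f1)
  (f2_totally_real : C_totally_real (atlas M2) f2)
  (I_open : open I) (I_interval : is_interval I) (I_nonempty : I !=set0)
  (gamma_sphere : forall t, I t -> usphere (gamma t))
  (gamma_smooth : smooth_on I gamma)
  (gamma_immersed : forall t, I t -> derive1 gamma t != 0)
  (G_immersion :
     sphere_immersion
       (prod_atlas (interval_atlas I) (prod_atlas (atlas M1) (atlas M2)))
       (spiral_product gamma f1 f2)) :
  is_minimal (prod_atlas (interval_atlas I) (prod_atlas (atlas M1) (atlas M2)))
    (spiral_product gamma f1 f2)
  <->
  [/\ is_minimal (atlas M1) f1,
      is_minimal (atlas M2) f2 &
      unparametrized_geodesic_S3 (weighted_metric k1 k2) I gamma].
Proof.
pose ci : chart R R 1 :=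
  Chart I [set u : 'rV[R]_1 | I (u 0 0)] (fun t => const_mx t) (fun u => u 0 0).
have Aprod c1 c2 : atlas M1 c1 -> atlas M2 c2 ->
    prod_atlas (interval_atlas I) (prod_atlas (atlas M1) (atlas M2))
      (prod_chart ci (prod_chart c1 c2)).
  by move=> A1 A2; exists ci => //; exists (prod_chart c1 c2) => //; exists c1 => //; exists c2.
have domE (c1 : chart R M1 k1) (c2 : chart R M2 k2) :
    spiral_domain I (chart_cod c1) (chart_cod c2) =
    chart_cod (prod_chart ci (prod_chart c1 c2)).
  by apply/seteqP; split=> u /=; [move=> []|move=> [? []]].
(* In a product chart the spiral product is a [spiral_coord] of the chart
   expressions of its factors. *)
have local c1 c2 u : atlas M1 c1 -> atlas M2 c2 ->
    spiral_domain I (chart_cod c1) (chart_cod c2) u ->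
    (mean_curvature (spiral_product gamma f1 f2 \o
        param (prod_chart ci (prod_chart c1 c2))) u = 0 <->
     [/\ mean_curvature (f1 \o param c1) (first_part u) = 0,
         mean_curvature (f2 \o param c2) (second_part u) = 0 &
         weighted_geodesic_curvature_free k1 k2 gamma (time_part u)]) /\
    weight_regular k1 k2 (gamma (time_part u)).
  move=> A1 A2 Du.
  have [ oc1 s1 sph1 real1 imm1] := chart_immersion_data f1_immersion f1_totally_real A1.
  have [ oc2 s2 sph2 real2 imm2] := chart_immersion_data f2_immersion f2_totally_real A2.
  have [_ sG immG] := G_immersion _ (Aprod _ _ A1 A2).
  rewrite -domE in sG immG; split.
    exact: (@spiral_mean_curvature_eq0P R k1 k2 _ _ gamma (f1 \o param c1)
      (f2 \o param c2) I (chart_cod c1) (chart_cod c2)).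
  exact: (@spiral_nondegenerate R k1 k2 _ _ gamma (f1 \o param c1)
      (f2 \o param c2) I (chart_cod c1) (chart_cod c2)).
have [d1 [x1 [Ad1 dx1]]] := manifold_point_chart M1_nonempty.
have [d2 [x2 [Ad2 dx2]]] := manifold_point_chart M2_nonempty.
have [t0 It0] := I_nonempty.
(* Points of the three factors can be chosen independently. *)
pose glue t x y : 'rV[R]_(1 + (k1 + k2)) := row_mx (const_mx t) (row_mx x y).
have glueE t x y : [/\ time_part (glue t x y) = t, first_part (glue t x y) = x &
    second_part (glue t x y) = y].
  rewrite /time_part /first_part /second_part /glue.
  by rewrite !(row_mxKl, row_mxKr) mxE.
have glueD t x y (c1 : chart R M1 k1) (c2 : chart R M2 k2) :
    I t -> chart_cod c1 x -> chart_cod c2 y ->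
    spiral_domain I (chart_cod c1) (chart_cod c2) (glue t x y).
  by rewrite /spiral_domain /=; have [-> -> ->] := glueE t x y; split.
have regular t : I t -> weight_regular k1 k2 (gamma t).
  move=> It; have [_] := local _ _ _ Ad1 Ad2 (glueD t x1 x2 d1 d2 It dx1 dx2).
  by have [-> _ _] := glueE t x1 x2.
have gamma_immersed' t : I t -> 'D_1 gamma t != 0.
  by move=> It; rewrite -derive1E; exact: gamma_immersed.
have geoP := unparametrized_geodesicP I_open I_interval I_nonempty gamma_smooth
  gamma_sphere gamma_immersed' regular.
split=> [min|[min1 min2 /geoP geo]].
  have split_min c1 c2 t x y : atlas M1 c1 -> atlas M2 c2 -> I t ->
      chart_cod c1 x -> chart_cod c2 y ->
      [/\ mean_curvature (f1 \o param c1) x = 0,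
          mean_curvature (f2 \o param c2) y = 0 &
          weighted_geodesic_curvature_free k1 k2 gamma t].
    move=> A1 A2 It c1x c2y; have Du := glueD t x y c1 c2 It c1x c2y.
    have [[+ _] _] := local _ _ _ A1 A2 Du; have [-> -> ->] := glueE t x y.
    by apply; apply: min (Aprod _ _ A1 A2) _; rewrite -domE.
  split.
  - by move=> c x Ac cx; have [] := split_min c d2 t0 x x2 Ac Ad2 It0 cx dx2.
  - by move=> c y Ac cy; have [] := split_min d1 c t0 x1 y Ad1 Ac It0 dx1 cy.
  - by apply/geoP => t It; have [] := split_min d1 d2 t x1 x2 Ad1 Ad2 It dx1 dx2.
move=> _ u [_ -> [_ [c1 A1 [c2 A2 <-]] <-]]; rewrite -domE => Du.
have [It Ox Oy] := Du; have [[_ +] _] := local _ _ _ A1 A2 Du; apply.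
by split; [exact: min1|exact: min2|exact: geo].
Qed.
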